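(* Let $G$ be a group acting by automorphisms on an abelian group $A$, where $G$, $A$ and the action of $G$ on $A$ are $\emptyset$-definable in a first-order structure $\mathcal G$ in a countable language. Let $B\subset\mathcal G$ be a finite parameter set and let $h\colon G\times G\to A$ be a 2-cocycle which is $B$-definable in $\mathcal G$ and has finite image $\mathrm{Im}(h)\subseteq\mathrm{dcl}(B)$. Let $A_0\le A$ be the subgroup generated by $\mathrm{Im}(h)$. Let $\mathcal G^*\succ\mathcal G$ be a monster model, and let $A_1^*$ be a bounded index subgroup of $A^*$ which is type-definable over $B$ and invariant under the action of $G^*$. Let $\widetilde{G}$ be the extension of $G$ by $A$ defined by $h$ and $\widetilde{G^*}$ its interpretation in $\mathcal G^*$. Suppose ${G^*}^{000}_B={G^*}^{00}_B$ and $A_1^*\subseteq\widetilde{G^*}^{000}_B\cap A^*$. If $\widetilde{G^*}^{000}_B\ne\widetilde{G^*}^{00}_B$, then the induced 2-cocycle $\overline{h^*}_{|{G^*}^{00}_B\times{G^*}^{00}_B}\colon{G^*}^{00}_B\times{G^*}^{00}_B\to A_0/(A_1^*\cap A_0)$ is non-split via $B$-invariant functions.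
   Context: Cocycles. If a group $G$ acts by automorphisms on an abelian group $A$ (written additively), a 2-cocycle is a map $h\colon G\times G\to A$ with $h(g_1,g_2)+h(g_1g_2,g_3)=h(g_1,g_2g_3)+g_1\cdot h(g_2,g_3)$ and $h(g,e)=h(e,g)=0$ for all $g,g_1,g_2,g_3\in G$. It defines the extension $\widetilde G=A\times G$ with product $(a_1,g_1)*(a_2,g_2)=(a_1+g_1\cdot a_2+h(g_1,g_2),\,g_1g_2)$; $A$ is identified with the subgroup $A\times\{e\}$ (and $A^*$ with $A^*\times\{e\}$). The 2-cocycle $h$ is split via $f\colon G\to A$ if $f(e)=0$ and $h(g_1,g_2)=f(g_1)+g_1\cdot f(g_2)-f(g_1g_2)$ for all $g_1,g_2\in G$. It is non-split via $B$-invariant functions if it is split via no $B$-invariant function. Model theory. A monster model $\mathcal G^*\succ\mathcal G$ is a $\kappa$-saturated, strongly $\kappa$-homogeneous elementary extension for a sufficiently large cardinal $\kappa$; ''small'' and ''bounded'' mean of cardinality $<\kappa$. For an object $X$ definable in $\mathcal G$, $X^*$ denotes its interpretation in $\mathcal G^*$. ''$B$-invariant'' means invariant under $\mathrm{Aut}(\mathcal G^*/B)$. For a group $K$ definable over $B$ in $\mathcal G^*$: $K^{00}_B$ is the smallest subgroup of $K$ of bounded index which is type-definable over $B$, and $K^{000}_B$ is the smallest $B$-invariant subgroup of $K$ of bounded index. Induced cocycle. The map $h^*$ has image $\mathrm{Im}(h)\subseteq A_0$, the group $A_0$ is invariant under the action of $G^*$, and ${G^*}^{00}_B$ acts trivially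 on $A_0$; $\overline{h^*}$ is the composition of $h^*$ with the quotient map $A_0\to A_0/(A_1^*\cap A_0)$. *)

(* Defs.v *)
From mathcomp Require Import all_boot.
From mathcomp Require Import boolp classical_sets functions cardinality.

Set Implicit Arguments.
Unset Strict Implicit.
Unset Printing Implicit Defensive.

Local Open Scope classical_set_scope.
Local Open Scope card_scope.

Record language := Language {
  fsym : Type;
  fsym_arity : fsym -> nat;
  rsym : Type;
  rsym_arity : rsym -> nat }.

Definition countable_language (L : language) : Prop :=
  countable [set: fsym L] /\ countable [set: rsym L].

(* The chosen point only records that the universe is nonempty (and serves as
   the default value of [xget]); the language does not name it. *)
Record structure (L : language) := Structure {
  carrier :> pointedType;
  fint : forall f : fsym L, ('I_(fsym_arity f) -> carrier) -> carrier;
  rint : forall r : rsym L, ('I_(rsym_arity r) -> carrier) -> Prop }.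

(* [V] is the type of free variables; a quantifier binds the variable [None]
   of [option V].  An L(B)-formula in the variables [V] is an element of
   [formula L (V + B)]: the elements of [B] serve as the new constants. *)
Inductive term (L : language) (V : Type) : Type :=
| Var of V
| App (f : fsym L) of ('I_(fsym_arity f) -> term L V).

Inductive formula (L : language) (V : Type) : Type :=
| FFalse
| FEq of term L V & term L V
| FRel (r : rsym L) of ('I_(rsym_arity r) -> term L V)
| FImp of formula L V & formula L V
| FAll of formula L (option V).

Fixpoint eval L (M : structure L) (V : Type) (e : V -> M) (t : term L V) : M :=
  match t with
  | Var v => e v
  | App f args => @fint L M f (fun i => eval e (args i))
  end.

Fixpoint sat L (M : structure L) (V : Type) (phi : formula L V) : (V -> M) -> Prop :=
  match phi with
  | FFalse => fun=> False
  | FEq t u => fun e => eval e t = eval e u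
  | FRel r args => fun e => @rint L M r (fun i => eval e (args i))
  | FImp p q => fun e => sat p e -> sat q e
  | FAll p => fun e => forall x : M, sat p (oapp e x)
  end.

(* Tuples of elements of [T] are functions [V -> T]; [join] concatenates. *)
Definition join (T V W : Type) (x : V -> T) (y : W -> T) : V + W -> T :=
  fun i => match i with inl v => x v | inr w => y w end.

Section Definability.
Variables (L : language) (M : structure L).

Definition realizes (B : set M) V (phi : formula L (V + B)) (x : V -> M) :=
  sat phi (join x val).

Definition definable (B : set M) V (X : set (V -> M)) : Prop :=
  exists phi : formula L (V + B), X = [set x | realizes phi x].

Definition type_definable (B : set M) V (X : set (V -> M)) : Prop :=
  exists Phi : set (formula L (V + B)),
    X = [set x | forall phi, Phi phi -> realizes phi x].

Definition dcl (B : set M) V : set (V -> M) := [set a | definable B [set a]].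

Definition graph2 U V W (X : set (U -> M)) (Y : set (V -> M))
    (f : (U -> M) -> (V -> M) -> (W -> M)) : set (U + V + W -> M) :=
  [set join (join x y) (f x y) | x in X & y in Y].

Definition is_automorphism (s : M -> M) : Prop :=
  [/\ bijective s,
      forall (f : fsym L) (x : 'I_(fsym_arity f) -> M),
        s (fint x) = fint (s \o x)
    & forall (r : rsym L) (x : 'I_(rsym_arity r) -> M),
        rint x <-> rint (s \o x)].

Definition Aut (B : set M) : set (M -> M) :=
  [set s | is_automorphism s /\ forall b, B b -> s b = b].

Definition invariant (B : set M) V (X : set (V -> M)) : Prop :=
  forall s, Aut B s -> forall x, X (s \o x) <-> X x.

(* Invariance of the graph of a function on [X] whose values are sets of
   tuples, on which automorphisms act elementwise. *)
Definition invariant_fun (B : set M) V W (X : set (V -> M))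
    (f : (V -> M) -> set (W -> M)) : Prop :=
  forall s, Aut B s ->
    forall x, X x -> f (s \o x) = [set s \o y | y in f x].

(* A cardinal is represented by a type [kappa] having that cardinality. *)
Definition small (kappa T : Type) (X : set T) : Prop :=
  ~ ([set: kappa] #<= X).

Definition saturated (kappa : Type) : Prop :=
  forall C : set M, small kappa C ->
  forall p : set (formula L (unit + C)),
    (forall p0 : set (formula L (unit + C)), finite_set p0 -> p0 `<=` p ->
       exists x : unit -> M, forall phi, p0 phi -> realizes phi x) ->
    exists x : unit -> M, forall phi, p phi -> realizes phi x.

Definition strongly_homogeneous (kappa : Type) : Prop :=
  forall C : set M, small kappa C ->
  forall f : M -> M,
    (forall phi : formula L C, sat phi val <-> sat phi (f \o val)) ->
    exists2 s, is_automorphism s & forall c, C c -> s c = f c.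

End Definability.

Definition elementary_embedding L (M N : structure L) (j : M -> N) : Prop :=
  forall V (phi : formula L V) (e : V -> M), sat phi e <-> sat phi (j \o e).

(* For a countable language, "kappa sufficiently large" is read as
   kappa > 2 ^ (|M| + aleph_0). *)
Definition monster L (M N : structure L) (j : M -> N) (kappa : Type) : Prop :=
  [/\ small kappa [set: set (M + nat)],
      elementary_embedding j,
      saturated N kappa
    & strongly_homogeneous N kappa].

(* Operations are total functions; only their values on [gset] matter.  The
   group axioms are stated separately, in [is_group]. *)
Record pregroup (T : pointedType) := Pregroup {
  gset :> set T;
  gmul : T -> T -> T;
  gone : T }.

Section Groups.
Variable T : pointedType.
Implicit Type K : pregroup T.

Definition is_group K : Prop :=
  [/\ gset K (gone K),
      forall x y, gset K x -> gset K y -> gset K (gmul K x y),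
      forall x y z, gset K x -> gset K y -> gset K z ->
        gmul K x (gmul K y z) = gmul K (gmul K x y) z,
      forall x, gset K x -> gmul K (gone K) x = x /\ gmul K x (gone K) = x
    & forall x, gset K x ->
        exists2 y, gset K y & gmul K x y = gone K /\ gmul K y x = gone K].

Definition is_abelian_group K : Prop :=
  is_group K /\ forall x y, gset K x -> gset K y -> gmul K x y = gmul K y x.

Definition ginv K (x : T) : T :=
  xget point [set y | gset K y /\ gmul K x y = gone K].

Definition subpregroup K (H : set T) : pregroup T :=
  Pregroup H (gmul K) (gone K).

Definition is_subgroup K (H : set T) : Prop :=
  H `<=` K /\ is_group (subpregroup K H).

Definition generated K (S : set T) : set T :=
  smallest (is_subgroup K) S.

Definition coset K (H : set T) (x : T) : set T := [set gmul K x y | y in H].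

Definition quotient K (H : set T) : pregroup (set T) :=
  Pregroup [set coset K H x | x in K]
           (fun X Y => [set gmul K x y | x in X & y in Y])
           H.

Definition bounded_index (kappa : Type) K (H : set T) : Prop :=
  small kappa [set coset K H x | x in K].

End Groups.

Definition acts_by_automorphisms (S T : pointedType) (G : pregroup S) (A : pregroup T)
    (act : S -> T -> T) : Prop :=
  [/\ forall g a, gset G g -> gset A a -> gset A (act g a),
      forall a, gset A a -> act (gone G) a = a,
      forall g1 g2 a, gset G g1 -> gset G g2 -> gset A a ->
        act (gmul G g1 g2) a = act g1 (act g2 a)
    & forall g a b, gset G g -> gset A a -> gset A b ->
        act g (gmul A a b) = gmul A (act g a) (act g b)].

Definition is_cocycle (S T : pointedType) (G : pregroup S) (A : pregroup T)
    (act : S -> T -> T) (h : S -> S -> T) : Prop :=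
  [/\ forall g1 g2, gset G g1 -> gset G g2 -> gset A (h g1 g2),
      forall g1 g2 g3, gset G g1 -> gset G g2 -> gset G g3 ->
        gmul A (h g1 g2) (h (gmul G g1 g2) g3) =
        gmul A (h g1 (gmul G g2 g3)) (act g1 (h g2 g3))
    & forall g, gset G g -> h g (gone G) = gone A /\ h (gone G) g = gone A].

Definition split_via (S T : pointedType) (G : pregroup S) (A : pregroup T)
    (act : S -> T -> T) (h : S -> S -> T) (f : S -> T) : Prop :=
  [/\ forall g, gset G g -> gset A (f g),
      f (gone G) = gone A
    & forall g1 g2, gset G g1 -> gset G g2 ->
        h g1 g2 = gmul A (gmul A (f g1) (act g1 (f g2)))
                         (ginv A (f (gmul G g1 g2)))].

Definition cocycle_image (S T : pointedType) (G : pregroup S) (h : S -> S -> T) : set T :=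
  [set h g1 g2 | g1 in G & g2 in G].

(* The underlying set is A x G; the pair (a, g) is the tuple [join a g]. *)
Definition extension (T : pointedType) U V (G : pregroup (V -> T)) (A : pregroup (U -> T))
    (act : (V -> T) -> (U -> T) -> (U -> T))
    (h : (V -> T) -> (V -> T) -> (U -> T)) : pregroup (U + V -> T) :=
  Pregroup [set join a g | a in A & g in G]
    (fun x y => let a1 := x \o inl in let g1 := x \o inr in
                let a2 := y \o inl in let g2 := y \o inr in
                join (gmul A (gmul A a1 (act g1 a2)) (h g1 g2))
                     (gmul G g1 g2))
    (join (gone A) (gone G)).

Definition definable_group L (M : structure L) (B : set M) V
    (K : pregroup (V -> M)) : Prop :=
  definable B (gset K) /\ definable B (graph2 K K (gmul K)).

Section Interpretation.
Variables (L : language) (M N : structure L) (j : M -> N).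

(* For [X] definable with parameters in [M] this is the set defined in [N] by
   any formula defining [X]: by elementarity the choice is irrelevant. *)
Definition star V (X : set (V -> M)) : set (V -> N) :=
  [set y | exists2 phi : formula L (V + M),
             X = [set x | sat phi (join x id)] & sat phi (join y j)].

Definition star_fun2 U V W (X : set (U -> M)) (Y : set (V -> M))
    (f : (U -> M) -> (V -> M) -> (W -> M)) (x : U -> N) (y : V -> N) : W -> N :=
  xget point [set z | star (graph2 X Y f) (join (join x y) z)].

Definition star_group V (K : pregroup (V -> M)) : pregroup (V -> N) :=
  Pregroup (star K) (star_fun2 K K (gmul K)) (j \o gone K).

End Interpretation.

Definition conn00 L (N : structure L) (kappa : Type) (B : set N) V
    (K : pregroup (V -> N)) : set (V -> N) :=
  smallest [set H | [/\ is_subgroup K H, bounded_index kappa K H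
                      & type_definable B H]] set0.

Definition conn000 L (N : structure L) (kappa : Type) (B : set N) V
    (K : pregroup (V -> N)) : set (V -> N) :=
  smallest [set H | [/\ is_subgroup K H, bounded_index kappa K H
                      & invariant B H]] set0.

(* The elements of the coefficient group [Q] are sets of tuples: it is meant to
   be a quotient of a subgroup of N^V. *)
Definition nonsplit_via_invariant L (N : structure L) (B : set N) U V
    (G : pregroup (U -> N)) (Q : pregroup (set (V -> N)))
    (act : (U -> N) -> set (V -> N) -> set (V -> N))
    (h : (U -> N) -> (U -> N) -> set (V -> N)) : Prop :=
  ~ exists2 f : (U -> N) -> set (V -> N),
      invariant_fun B G f & split_via G Q act h f.

(* Main.v *)
Require Import Defs.
From mathcomp Require Import all_boot.
From mathcomp Require Import boolp classical_sets functions cardinality.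
Local Open Scope classical_set_scope.

(** Suppose that the cocycle splits through an invariant function [f]; it is shown
    that the two components of the extension are then equal.  Write [G] and [A]
    for the groups in the monster model, [E] for the extension, [P] for the
    common value of the two components of [G], and put
      K = {(a, g) : g in P and a + f g is contained in A1}.
    The splitting identity says that [g |-> (- f g, g)] is multiplicative modulo
    [A1], so [K] is a subgroup of [E].  It is invariant, it has bounded index
    because [P] and [A1] do, it projects onto [P], and it meets [A] in [A1].

    Every invariant subgroup [H] of bounded index of [E] contains [K]: the
    projection of [H `&` K] is an invariant subgroup of bounded index of [G], so
    it contains [P], and the kernel [A1] of the projection of [K] is contained
    in [H] by assumption ([splitting_group_sub_conn000]).  It remains to see that
    [K] is type-definable, for then it contains the type-definable component,
    which is therefore contained in the invariant one.

    The function [f] need not be definable, but it is constant on types over [B].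
    Let [F] be the set of quotients [x^-1 y] of elements of [P] that have the
    same type over [B].  On [F] the function [f] is computed from the cocycle:
    [(0, x)^-1 (0, y)] belongs to [K], because [f x = f y].  Moreover [F] is
    type-definable and generates an invariant subgroup of bounded index, hence
    all of [P] ([conn00_generated]).  A type-definable group that is the union
    of an increasing sequence of type-definable pieces, compatible with the
    group operations, equals one of them ([finitely_many_steps], a Baire category
    argument in a minimal flow).  So [P] consists of the products of [k] elements
    of [F] for some [k], and [K] is the product of [A1] with the set of products
    of [k] elements of the form [(0, x)^-1 (0, y)]; products of type-definable
    sets are type-definable ([type_definable_splitting_group]).

    Three general facts support this: compactness and homogeneity for finite
    tuples in the monster model ([compact], [homogeneous]); the bounded index of
    the type-definable component, which rests on the existence of finite nets
    and on the countability of the set of formulas ([bounded_index_conn00]); and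
    the transfer of the groups, the action and the cocycle along the elementary
    embedding, by treating the two models as one family in which a single formula
    defines each set ([udef_transfer]).  Products of small sets are small since
    an infinite set is as large as its square ([card_le_square]). *)

Set Implicit Arguments.
Unset Strict Implicit.
Unset Printing Implicit Defensive.
Local Open Scope card_scope.

(** * Tuples *)

Lemma join_inl T V W (x : V -> T) (y : W -> T) : join x y \o inl = x.
Proof. by []. Qed.

Lemma join_inr T V W (x : V -> T) (y : W -> T) : join x y \o inr = y.
Proof. by []. Qed.

Lemma joinK T V W (x : V + W -> T) : join (x \o inl) (x \o inr) = x.
Proof. by apply: funext => -[]. Qed.

Lemma comp_join T T' V W (s : T -> T') (x : V -> T) (y : W -> T) :
  s \o join x y = join (s \o x) (s \o y).
Proof. by apply: funext => -[]. Qed.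

Lemma join_inj T V W (x x' : V -> T) (y y' : W -> T) :
  join x y = join x' y' -> x = x' /\ y = y'.
Proof.
move=> e; split; first by rewrite -(join_inl x y) e.
by rewrite -(join_inr x y) e.
Qed.

(** * Renaming of free variables *)

Fixpoint term_map L V W (r : V -> W) (t : term L V) : term L W :=
  match t with
  | Var v => Var L (r v)
  | App f args => App (fun i => term_map r (args i))
  end.

Fixpoint formula_map L V W (r : V -> W) (phi : formula L V) : formula L W :=
  match phi with
  | FFalse => FFalse L W
  | FEq t u => FEq (term_map r t) (term_map r u)
  | FRel R args => FRel (fun i => term_map r (args i))
  | FImp p q => FImp (formula_map r p) (formula_map r q)
  | FAll p => FAll (formula_map (omap r) p)
  end.

Lemma eval_map L (M : structure L) V W (r : V -> W) (t : term L V) (e : W -> M) :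
  eval e (term_map r t) = eval (e \o r) t.
Proof. by elim: t => //= f args IH; congr fint; apply: funext => i. Qed.

Lemma sat_map L (M : structure L) V (phi : formula L V) :
  forall W (r : V -> W) (e : W -> M), sat (formula_map r phi) e <-> sat phi (e \o r).
Proof.
elim: phi => {V} [V|V t u|V R args|V p IHp q IHq|V p IH] W r e /=.
- by [].
- by rewrite !eval_map.
- rewrite (_ : (fun i => eval e _) = (fun i => eval (e \o r) (args i))) //.
  by apply: funext => i; rewrite eval_map.
- by rewrite IHp IHq.
- have E x : oapp e x \o omap r = oapp (e \o r) x by apply: funext => -[].
  by split=> H x; move/(_ x): H; rewrite IH E.
Qed.

(** * Uniform definability in a family of structures *)

(** The structures [S i] share a language, and [c i] names the same parameters
    in each of them.  Transfer along an elementary embedding is the case of two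
    structures, definability in the monster model that of one; both use the
    closure properties below. *)
Section UniformDefinability.
Variables (L : language) (I : Type) (S : I -> structure L) (C : Type).
Variable c : forall i, C -> S i.
Implicit Types V W : Type.

Definition udef V (P : forall i, (V -> S i) -> Prop) : Prop :=
  exists phi : formula L (V + C), forall i x, P i x <-> sat phi (join x (c i)).

(** Maps of tuples whose coordinates are variables or parameters: these are
    the substitutions that may be made in a formula. *)
Definition uterm V W (r : forall i, (V -> S i) -> (W -> S i)) : Prop :=
  exists rho : W -> V + C, forall i x, r i x = join x (c i) \o rho.

Lemma uterm_var V W (g : W -> V) : uterm (fun i (x : V -> S i) => x \o g).
Proof. by exists (inl \o g). Qed.

Lemma uterm_param V W (g : W -> C) : uterm (fun i (x : V -> S i) => c i \o g).
Proof. by exists (inr \o g). Qed.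

Lemma uterm_join V W W' (r : forall i, (V -> S i) -> (W -> S i))
    (r' : forall i, (V -> S i) -> (W' -> S i)) :
  uterm r -> uterm r' -> uterm (fun i x => join (r i x) (r' i x)).
Proof.
move=> [f Hf] [g Hg]; exists (fun w => match w with inl a => f a | inr b => g b end).
by move=> i x; rewrite Hf Hg; apply: funext => -[].
Qed.

Lemma uterm_comp V W W' (r : forall i, (V -> S i) -> (W -> S i)) (g : W' -> W) :
  uterm r -> uterm (fun i x => r i x \o g).
Proof. by move=> [f Hf]; exists (f \o g) => i x; rewrite Hf. Qed.

Lemma udef_ext V (P Q : forall i, (V -> S i) -> Prop) :
  udef P -> (forall i x, P i x <-> Q i x) -> udef Q.
Proof. by move=> [phi H] PQ; exists phi => i x; rewrite -PQ. Qed.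

Lemma udef_subst V W (P : forall i, (W -> S i) -> Prop)
    (r : forall i, (V -> S i) -> (W -> S i)) :
  udef P -> uterm r -> udef (fun i x => P i (r i x)).
Proof.
move=> [phi H] [f Hf].
exists (formula_map (fun w => match w with inl a => f a | inr b => inr b end) phi).
move=> i x; rewrite H sat_map Hf.
by rewrite (_ : join _ _ = join x (c i) \o
  (fun w : W + C => match w with inl a => f a | inr b => inr b end)) //;
   apply: funext => -[].
Qed.

Lemma udef_False V : udef (fun i (x : V -> S i) => False).
Proof. by exists (FFalse L _). Qed.

Lemma udef_imp V (P Q : forall i, (V -> S i) -> Prop) :
  udef P -> udef Q -> udef (fun i x => P i x -> Q i x).
Proof. by move=> [p Hp] [q Hq]; exists (FImp p q) => i x; rewrite Hp Hq. Qed.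

Lemma udef_not V (P : forall i, (V -> S i) -> Prop) :
  udef P -> udef (fun i x => ~ P i x).
Proof. by move=> dP; apply: udef_imp => //; apply: udef_False. Qed.

Lemma udef_True V : udef (fun i (x : V -> S i) => True).
Proof. by apply: (udef_ext (udef_not (udef_False V))) => i x; split=> // _ []. Qed.

Lemma udef_and V (P Q : forall i, (V -> S i) -> Prop) :
  udef P -> udef Q -> udef (fun i x => P i x /\ Q i x).
Proof.
move=> dP dQ; apply: (udef_ext (udef_not (udef_imp dP (udef_not dQ)))) => i x.
split=> [/not_implyP[p /contrapT q]|[p q] pq]; first by split.
exact: pq.
Qed.

Lemma udef_eq1 V (r r' : forall i, (V -> S i) -> (unit -> S i)) :
  uterm r -> uterm r' -> udef (fun i x => r i x tt = r' i x tt).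
Proof.
move=> [f Hf] [g Hg]; exists (FEq (Var L (f tt)) (Var L (g tt))) => i x /=.
by rewrite Hf Hg.
Qed.

Lemma udef_forall_fin V (W : finType) (P : W -> forall i, (V -> S i) -> Prop) :
  (forall w, udef (P w)) -> udef (fun i x => forall w, P w i x).
Proof.
move=> dP.
suff H (s : seq W) : udef (fun i x => forall w, w \in s -> P w i x).
  by apply: (udef_ext (H (enum W))) => i x; split=> Q w; have := Q w; rewrite mem_enum; auto.
elim: s => [|w s IH]; first by apply: (udef_ext (udef_True V)).
apply: (udef_ext (udef_and (dP w) IH)) => i x; split=> [[Pw Ps] w'|H].
  by rewrite inE => /predU1P[->|/Ps].
by split=> [|w' w's]; apply: H; rewrite inE ?eqxx ?w's ?orbT.
Qed.

Lemma udef_eq V (W : finType) (r r' : forall i, (V -> S i) -> (W -> S i)) :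
  uterm r -> uterm r' -> udef (fun i x => r i x = r' i x).
Proof.
move=> tr tr'; apply: (@udef_ext _ (fun i x => forall w, r i x w = r' i x w)); last first.
  by move=> i x; split=> [/funext//|->].
apply: udef_forall_fin => w.
exact: (udef_eq1 (uterm_comp (fun=> w) tr) (uterm_comp (fun=> w) tr')).
Qed.

Lemma udef_all1 V (P : forall i, (option V -> S i) -> Prop) :
  udef P -> udef (fun i x => forall a, P i (oapp x a)).
Proof.
move=> [phi H].
exists (FAll (formula_map (fun w => match w with
   inl v => omap inl v | inr b => Some (inr b) end) phi)) => i x /=.
have E a : oapp x a = oapp x a by [].
by split=> Q a; move/(_ a): Q; rewrite H sat_map; congr (sat _ _);
   apply: funext => -[[v|]|b].
Qed.

(** A quantifier over a finite tuple [y : W -> S i] is unfolded into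
    quantifiers over its coordinates, by updating them one after the other;
    the values that the tuple had at the start are forgotten in the end, and
    one more quantified element serves for all of them. *)
Lemma udef_all V (W : finType) (P : forall i, (V -> S i) -> (W -> S i) -> Prop) :
  udef (fun i (x : V + W -> S i) => P i (x \o inl) (x \o inr)) ->
  udef (fun i x => forall y, P i x y).
Proof.
move=> dP.
have H (s : seq W) : udef (fun i (x : V + W -> S i) =>
    forall y', (forall w, w \notin s -> y' w = x (inr w)) -> P i (x \o inl) y').
  elim: s => [|w s IH].
    apply: (udef_ext dP) => i x; split=> [Px y' y'E|]; last by apply.
    by rewrite (_ : y' = x \o inr) //; apply: funext => w; apply: y'E.
  pose rho (u : V + W) : option (V + W) := if u is inr w' then
     if w' == w then None else Some u else Some u.
  apply: (udef_ext (udef_all1 (udef_subst IH (uterm_var rho)))) => i x; split=> Q.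
    move=> y y'E; apply: (Q (y w) y) => w' w's /=.
    have [->//|ne] := eqVneq w' w.
    by rewrite /= y'E // inE negb_or ne.
  move=> a y y'E; apply: Q => w'; rewrite inE negb_or => /andP[ne w's].
  by rewrite y'E //= (negPf ne).
pose rho (u : V + W) : option V := if u is inl v then Some v else None.
apply: (udef_ext (udef_all1 (udef_subst (H (enum W)) (uterm_var rho)))) => i x.
split=> [Q y|Q a y _]; last exact: Q.
by apply: (Q point y) => w; rewrite mem_enum.
Qed.

Lemma udef_ex V (W : finType) (P : forall i, (V -> S i) -> (W -> S i) -> Prop) :
  udef (fun i (x : V + W -> S i) => P i (x \o inl) (x \o inr)) ->
  udef (fun i x => exists y, P i x y).
Proof.
move=> dP.
have := udef_not (@udef_all V W (fun i x y => ~ P i x y) (udef_not dP)).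
move/udef_ext; apply=> i x; split=> [/existsNP[y /contrapT]|[y Py] /(_ y)].
  by exists y.
exact.
Qed.

End UniformDefinability.

(** * Cardinal arithmetic *)

Lemma card_le_rel T U (A : set T) (B : set U) (R : T -> U -> Prop) :
  (forall x, A x -> exists2 y, B y & R x y) ->
  (forall x x' y, A x -> A x' -> R x y -> R x' y -> x = x') -> A #<= B.
Proof.
move=> tot inj.
have /choice[f Hf] : forall x : A, exists y : B, R (val x) (val y).
  move=> x; have [y By Rxy] := tot _ (set_mem (valP x)).
  by exists (SigSub (mem_set By)).
have fun_f : set_fun [set: A] [set: B] f by [].
have inj_f : set_inj [set: A] f.
  move=> x x' _ _ e; apply: val_inj; apply: inj (Hf x) _; try exact: set_mem (valP _).
  by rewrite e.
by apply/card_leP/injfunPex; exists f.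
Qed.

Lemma card_le_fun_rel T U (A : set T) (B : set U) : A #<= B ->
  exists R : T -> U -> Prop,
    [/\ forall x, A x -> exists y, R x y,
        forall x y, R x y -> A x /\ B y,
        forall x x' y, R x y -> R x' y -> x = x'
      & forall x y y', R x y -> R x y' -> y = y'].
Proof.
move=> /card_leP[f]; exists (fun x y => exists2 a : A, val a = x & val (f a) = y).
split=> [x Ax|x y [a <- <-]|x x' y [a <- <-] [b <- e]|x y y' [a <- <-] [b + <-]].
- by exists (val (f (SigSub (mem_set Ax)))), (SigSub (mem_set Ax)).
- by split; apply: set_mem; apply: valP.
- by congr val; apply: (@inj _ _ setT f); rewrite ?in_setT //; apply: val_inj.
- by move=> /val_inj->.
Qed.

Lemma card_le_total T U (A : set T) (B : set U) : A #<= B \/ B #<= A.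
Proof.
pose P (G : set (T * U)) := [/\ forall p, G p -> A p.1 /\ B p.2,
  forall x x' y, G (x, y) -> G (x', y) -> x = x'
  & forall x y y', G (x, y) -> G (x, y') -> y = y'].
have [F FP totF|G [[GAB Gi Gf] Gmax]] := @Zorn_bigcup _ P.
  have two p q : (\bigcup_(X in F) X) p -> (\bigcup_(X in F) X) q ->
      exists2 X, F X & X p /\ X q.
    move=> [X FX Xp] [Y FY Yq]; have [XY|YX] := totF _ _ FX FY.
      by exists Y => //; split=> //; apply: XY.
    by exists X => //; split=> //; apply: YX.
  split=> [p [X /FP[+ _ _]]|x x' y p q|x y y' p q]; first by apply.
    by have [X /FP[_ + _] [Xp Xq]] := two _ _ p q; apply; [exact: Xp|exact: Xq].
  by have [X /FP[_ _ +] [Xp Xq]] := two _ _ p q; apply; [exact: Xp|exact: Xq].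
have [tA|/existsNP[a /not_implyP[Aa na]]] :=
    pselect (forall x, A x -> exists y, G (x, y)).
  left; apply: (@card_le_rel _ _ _ _ (fun x y => G (x, y))) => [x /tA[y Gxy]|x x' y _ _].
    by exists y => //; have [] := GAB _ Gxy.
  exact: Gi.
have [tB|/existsNP[b /not_implyP[Bb nb]]] :=
    pselect (forall y, B y -> exists x, G (x, y)).
  right; apply: (@card_le_rel _ _ _ _ (fun y x => G (x, y))) => [y /tB[x Gxy]|x x' y _ _].
    by exists x => //; have [] := GAB _ Gxy.
  exact: Gf.
case: (Gmax (G `|` [set (a, b)])).
  rewrite properEneq; split; last by move=> p; left.
  apply/eqP => E; apply: na; exists b; rewrite E; by right.
split=> [p [/GAB//|->//]|x x' y|x y y'].
- move=> [Gx|[ex ey]] [Gx'|[ex' ey']]; first exact: Gi Gx Gx'.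
  + by case: nb; exists x; rewrite -ey'.
  + by case: nb; exists x'; rewrite -ey.
  + by rewrite ex ex'.
- move=> [Gx|[ex ey]] [Gx'|[ex' ey']]; first exact: Gf Gx Gx'.
  + by case: na; exists y; rewrite -ex'.
  + by case: na; exists y'; rewrite -ex.
  + by rewrite ey ey'.
Qed.

(** The largest partial injection of a square [S * S] into [S] that extends a
    pairing of a countable subset has [#|A \ S| <= #|S|], since otherwise a copy
    of [S] outside [S] would have room for the three missing blocks of a larger
    square; so [S] is as large as [A]. *)
Lemma card_le_square T (A : set T) : infinite_set A -> A `*` A #<= A.
Proof.
move=> /infiniteP/card_le_fun_rel[I0 [I0tot I0A I0inj I0fun]].
have /choice[u Hu] : forall k, exists y, I0 k y by move=> k; apply: I0tot.
have uA k : A (u k) by have [] := I0A _ _ (Hu k).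
have u_inj k l : u k = u l -> k = l by move=> e; apply: I0inj (Hu k) _; rewrite e.
pose dom (G : set ((T * T) * T)) x := exists z, G ((x, x), z).
pose G0 : set ((T * T) * T) := [set p | exists i j : nat,
  p = ((u i, u j), u (pickle (i, j)))].
pose P (G : set ((T * T) * T)) := [/\ forall x, dom G x -> A x,
  forall p z, G (p, z) -> [/\ dom G p.1, dom G p.2 & dom G z],
  forall x y, dom G x -> dom G y -> exists z, G ((x, y), z),
  forall p p' z, G (p, z) -> G (p', z) -> p = p'
  & G = set0 \/ G0 `<=` G].
have domG0 x : dom G0 x -> exists i, x = u i.
  by move=> [z [i [j [-> _ _]]]]; exists i.
have domu i : dom G0 (u i) by exists (u (pickle (i, i))), i, i.
have PG0 : P G0.
  split; last by right.
  - by move=> x /domG0[i ->].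
  - by move=> p z [i [j [-> ->]]]; split; apply: domu.
  - by move=> x y /domG0[i ->] /domG0[j ->]; exists (u (pickle (i, j))), i, j.
  - move=> p p' z [i [j [-> ->]]] [i' [j' [-> /u_inj/(pcan_inj pickleK)e]]].
    by case: e => -> ->.
have [F FP totF|G [[GA Gd Gtot Ginj GG0] Gmax]] := @Zorn_bigcup _ P.
  have two p q : (\bigcup_(X in F) X) p -> (\bigcup_(X in F) X) q ->
      exists2 X, F X & X p /\ X q.
    move=> [X FX Xp] [Y FY Yq]; have [XY|YX] := totF _ _ FX FY.
      by exists Y => //; split=> //; apply: XY.
    by exists X => //; split=> //; apply: YX.
  split.
  - by move=> x [z [X /FP[XA _ _ _ _] Xz]]; apply: XA; exists z.
  - move=> p z [X FX Xz]; have [_ Xd _ _ _] := FP _ FX.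
    have [[z1 D1] [z2 D2] [z3 D3]] := Xd _ _ Xz.
    by split; [exists z1, X|exists z2, X|exists z3, X].
  - move=> x y [z Xz] [z' Xz']; have [X FX [Xx Xy]] := two _ _ Xz Xz'.
    have [_ _ Xt _ _] := FP _ FX.
    have [w Xw] := Xt x y (ex_intro _ _ Xx) (ex_intro _ _ Xy).
    by exists w, X.
  - move=> p p' z Xz Xz'; have [X FX [Xx Xy]] := two _ _ Xz Xz'.
    by have [_ _ _ Xi _] := FP _ FX; apply: Xi Xx Xy.
  - have [[X FX XG0]|nF] := pselect (exists2 X, F X & G0 `<=` X).
      by right=> p /XG0 ?; exists X.
    left; apply/seteqP; split=> // p [X FX Xp].
    have [_ _ _ _ [X0|XG0]] := FP _ FX; first by rewrite X0 in Xp.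
    by case: nF; exists X.
have {GG0} GG0 : G0 `<=` G.
  case: GG0 => // G_0; case: (Gmax G0) => //.
  rewrite properEneq; split; last by rewrite G_0.
  rewrite G_0 eq_sym; apply/set0P; by exists ((u 0, u 0), u (pickle (0, 0))), 0, 0.
have Gu k : dom G (u k) by have [z ?] := domu k; exists z; apply: GG0.
have [le|] := card_le_total (A `\` dom G) (dom G).
  have [E [Etot EA Einj Efun]] := card_le_fun_rel le.
  have leS : A #<= dom G.
    apply: (@card_le_rel _ _ _ _ (fun x z => (dom G x /\ G ((x, u 0), z)) \/
       (~ dom G x /\ exists2 y, E x y & G ((y, u 1), z)))).
      move=> x Ax; have [Sx|nSx] := pselect (dom G x).
        have [z Gz] := Gtot _ _ Sx (Gu 0); exists z; last by left.
        by have [] := Gd _ _ Gz.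
      have [y Exy] := Etot x (conj Ax nSx); have [_ Sy] := EA _ _ Exy.
      have [z Gz] := Gtot _ _ Sy (Gu 1); exists z; last by right; split=> //; exists y.
      by have [] := Gd _ _ Gz.
    move=> x x' z _ _ [[Sx Gx]|[Sx [y Exy Gy]]] [[Sx' Gx']|[Sx' [y' Exy' Gy']]].
    - by case: (Ginj _ _ _ Gx Gx').
    - by case: (Ginj _ _ _ Gx Gy') => _ /u_inj.
    - by case: (Ginj _ _ _ Gy Gx') => _ /u_inj.
    - have [e] := Ginj _ _ _ Gy Gy'; rewrite -e in Exy'; exact: Einj Exy Exy'.
  have [R [Rtot RA Rinj Rfun]] := card_le_fun_rel leS.
  apply: (@card_le_rel _ _ _ _ (fun p z => exists x y,
    [/\ R p.1 x, R p.2 y & G ((x, y), z)])).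
    move=> [a b] [/= /Rtot[x Rx] /Rtot[y Ry]].
    have [_ Sx] := RA _ _ Rx; have [_ Sy] := RA _ _ Ry.
    have [z Gz] := Gtot _ _ Sx Sy; exists z; last by exists x, y.
    by apply: GA; have [] := Gd _ _ Gz.
  move=> [a b] [a' b'] z _ _ [x [y [/= Rx Ry Gz]]] [x' [y' [/= Rx' Ry' Gz']]].
  have [ex ey] := Ginj _ _ _ Gz Gz'; subst x' y'.
  by rewrite (Rinj _ _ _ Rx Rx') (Rinj _ _ _ Ry Ry').
move=> /card_le_fun_rel[E [Etot EA Einj Efun]]; exfalso.
have ES x y : E x y -> ~ dom G y by move=> /EA[_ []].
(* [E] carries [dom G] to a copy of it outside [dom G]; [tag x i v] says that [v]
   is [x] or its copy, according to [i], and [s i j] marks one block of the square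
   of the union. *)
pose tag x (i : bool) v := dom G x /\ if i then E x v else v = x.
have tag_inj x i v v' : tag x i v -> tag x i v' -> v = v'.
  by case: i => -[_ e] [_ e']; [apply: Efun e e'|rewrite e e'].
pose s (i j : bool) := u (i + j.*2).
have s_inj i j i' j' : s i j = s i' j' -> i = i' /\ j = j'.
  by move=> /u_inj; case: i i' j j' => -[] [] [].
pose G1 : set ((T * T) * T) := [set p | G p \/ exists x y i j z z2,
  [/\ tag x i p.1.1 /\ tag y j p.1.2, i || j, G ((x, y), z),
      G ((z, s i j), z2) & E z2 p.2]].
have domG1 v : dom G v \/ (exists2 x, dom G x & E x v) <-> exists x i, tag x i v.
  split=> [[Sv|[x Sx Exv]]|[x [[] [Sx]]]].
  - by exists v, false.
  - by exists x, true.
  - by move=> Exv; right; exists x.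
  - by move=> /= ->; left.
have totG1 v w : (exists x i, tag x i v) -> (exists x i, tag x i w) ->
    exists z, G1 ((v, w), z).
  move=> [x [i tv]] [y [j tw]].
  have [z Gz] := Gtot _ _ tv.1 tw.1.
  have [/= _ _ Sz] := Gd _ _ Gz.
  have [z2 Gz2] := Gtot _ _ Sz (Gu (i + j.*2)).
  have [/= _ _ /Etot[q Eq]] := Gd _ _ Gz2.
  case ij: (i || j); first by exists q; right; exists x, y, i, j, z, z2.
  case: i j tv tw ij {Gz2} => -[] // [_ /= ->] [_ /= ->] _.
  by exists z; left.
have domG1P v : dom G1 v <-> exists x i, tag x i v.
  split=> [[z [Gz|[x [y [i [j [z1 [z2 [[tx _] _ _ _ _]]]]]]]]]|tv].
  - by apply/domG1; left; exists z.
  - by exists x, i.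
  - exact: totG1.
case: (Gmax G1).
  rewrite properEneq; split; last by left.
  have [y Ey] := Etot _ (Gu 0); have Sy := ES _ _ Ey.
  apply/eqP => GE; apply: Sy; rewrite GE.
  by apply/domG1P/domG1; right; exists (u 0).
split; last by right=> p /GG0; left.
- move=> v /domG1P/domG1[/GA//|[x _ /EA[_ []]]] //.
- move=> p w [Gz|[x [y [i [j [z [z2 [[tx ty] ij Gz Gz2 E2]]]]]]]].
    by have [d1 d2 d3] := Gd _ _ Gz; split; apply/domG1P/domG1; left.
  split; apply/domG1P; [by exists x, i|by exists y, j|exists z2, true; split=> //].
  by have [] := EA _ _ E2.
- by move=> v w /domG1P tv /domG1P tw; apply: totG1.
- move=> [p1 p2] [q1 q2] w [Gz|[x [y [i [j [z [z2 [[/= tx ty] ij Gz Gz2 E2]]]]]]]]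
    [Gz'|[x' [y' [i' [j' [z' [z2' [[/= tx' ty'] ij' Gz' Gz2' E2']]]]]]]].
  + exact: Ginj Gz Gz'.
  + by case: (ES _ _ E2'); have [] := Gd _ _ Gz.
  + by case: (ES _ _ E2); have [] := Gd _ _ Gz'.
  + have e := Einj _ _ _ E2 E2'; rewrite -e in Gz2'.
    have [e1 /s_inj[e2 e3]] := Ginj _ _ _ Gz2 Gz2'; rewrite -e1 in Gz'.
    have [e4 e5] := Ginj _ _ _ Gz Gz'; subst.
    by rewrite (tag_inj _ _ _ _ tx tx') (tag_inj _ _ _ _ ty ty').
Qed.

Section Small.
Variable kappa : Type.
Hypothesis kappa_large : small kappa [set: set nat].

Lemma small_le T U (A : set T) (B : set U) : A #<= B -> small kappa B -> small kappa A.
Proof. by move=> AB sB /card_le_trans/(_ AB). Qed.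

Lemma small_sub T (A B : set T) : small kappa B -> A `<=` B -> small kappa A.
Proof. by move=> sB /subset_card_le/small_le; apply. Qed.

Lemma small_image T U (f : T -> U) (A : set T) : small kappa A -> small kappa (f @` A).
Proof. exact/small_le/card_image_le. Qed.

Lemma small_countable T (A : set T) : countable A -> small kappa A.
Proof.
move=> cA; apply: small_le kappa_large; apply: card_le_trans cA _.
apply: (@card_le_rel _ _ _ _ (fun k X => X = [set k])) => [k _|k l X _ _ -> e].
  by exists [set k].
by have : [set k] k by []; rewrite e.
Qed.

Lemma small_finite T (A : set T) : finite_set A -> small kappa A.
Proof. by move=> /finite_set_countable; apply: small_countable. Qed.

Lemma small_square T (A : set T) : small kappa A -> small kappa (A `*` A).
Proof.
move=> sA; have [fA|iA] := pselect (finite_set A).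
  by apply: small_finite; apply: finite_setX.
exact: small_le (card_le_square iA) sA.
Qed.

Lemma small_setX T U (A : set T) (B : set U) :
  small kappa A -> small kappa B -> small kappa (A `*` B).
Proof.
move=> sA sB; have [|] := card_le_total A B => /card_le_fun_rel[R [Rt RA Ri _]].
- apply: small_le (small_square sB).
  apply: (@card_le_rel _ _ _ _ (fun p q => R p.1 q.1 /\ p.2 = q.2)).
    move=> [a b] [/= /Rt[b' Rb'] Bb]; exists (b', b) => //; split=> //=.
    by have [] := RA _ _ Rb'.
  by move=> [a b] [a' b'] [c d] _ _ [/= r ->] [/= r' ->]; rewrite (Ri _ _ _ r r').
- apply: small_le (small_square sA).
  apply: (@card_le_rel _ _ _ _ (fun p q => R p.2 q.2 /\ p.1 = q.1)).
    move=> [a b] [/= Aa /Rt[a' Ra']]; exists (a, a') => //; split=> //=.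
    by have [] := RA _ _ Ra'.
  by move=> [a b] [a' b'] [c d] _ _ [/= r ->] [/= r' ->]; rewrite (Ri _ _ _ r r').
Qed.

Lemma small_setU T (A B : set T) :
  small kappa A -> small kappa B -> small kappa (A `|` B).
Proof.
move=> sA sB.
have [[a Aa]|nA] := pselect (A !=set0); last first.
  by rewrite (_ : A = set0) ?set0U //; apply/eqP/negP => /negP/set0P.
have [[b Bb]|nB] := pselect (B !=set0); last first.
  by rewrite (_ : B = set0) ?setU0 //; apply/eqP/negP => /negP/set0P.
have s2 : small kappa [set: bool] by apply: small_finite; apply: finite_finset.
pose f (p : bool * (T * T)) := if p.1 then p.2.1 else p.2.2.
apply: (small_sub (@small_image _ _ f _ (small_setX s2 (small_setX sA sB)))).
by move=> x [Ax|Bx]; [exists (true, (x, b))|exists (false, (a, x))].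
Qed.

End Small.

(** * Countably many formulas *)

(** Formulas are encoded by finite trees with natural labels; the code of a
    free variable is shifted when a quantifier is crossed, where [0] becomes the
    code of the bound variable. *)
Section CodeFormulas.
Variables (L : language) (cf : Defs.fsym L -> nat) (cr : rsym L -> nat).
Hypotheses (cf_inj : injective cf) (cr_inj : injective cr).

Fixpoint term_code V (cv : V -> nat) (t : term L V) : GenTree.tree nat :=
  match t with
  | Var v => GenTree.Leaf (cv v)
  | App f args => GenTree.Node (cf f) [seq term_code cv (args i) | i <- enum 'I_(fsym_arity f)]
  end.

Fixpoint formula_code V (cv : V -> nat) (phi : formula L V) : GenTree.tree nat :=
  match phi with
  | FFalse => GenTree.Node 0 [::]
  | FEq t u => GenTree.Node 1 [:: term_code cv t; term_code cv u]
  | FRel R args => GenTree.Node 2 (GenTree.Leaf (cr R) ::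
      [seq term_code cv (args i) | i <- enum 'I_(rsym_arity R)])
  | FImp p q => GenTree.Node 3 [:: formula_code cv p; formula_code cv q]
  | FAll p => GenTree.Node 4 [:: formula_code (fun v => oapp (fun v => (cv v).+1) 0 v) p]
  end.

Lemma map_enum_inj k T (f g : 'I_k -> T) :
  [seq f i | i <- enum 'I_k] = [seq g i | i <- enum 'I_k] -> f = g.
Proof. by move=> e; apply: funext => i; apply/eq_in_map: i (mem_enum 'I_k i). Qed.

Lemma term_code_inj V (cv : V -> nat) : injective cv -> injective (term_code cv).
Proof.
move=> cv_inj; elim=> [v|f args IH] [w|g args'] //= [].
  by move=> /cv_inj->.
move=> /cf_inj e; subst g => e; congr App; apply: funext => i; apply: IH.
by have /(congr1 (fun h => h i)) := map_enum_inj e.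
Qed.

Lemma formula_code_inj V (cv : V -> nat) : injective cv -> injective (formula_code cv).
Proof.
move=> cv_inj phi; elim: phi cv cv_inj => {V} [V|V t u|V R args|V p IHp q IHq|V p IH]
  cv cv_inj [|t' u'|R' args'|p' q'|p'] //=.
- by move=> [/(term_code_inj cv_inj)-> /(term_code_inj cv_inj)->].
- move=> [/cr_inj e]; subst R' => e; congr FRel; apply: funext => i.
  apply: (term_code_inj cv_inj).
  by have /(congr1 (fun h => h i)) := map_enum_inj e.
- by move=> [/(IHp _ cv_inj)-> /(IHq _ cv_inj)->].
- move=> [/IH->] // [v|] [w|] //= [/cv_inj->] //.
Qed.

End CodeFormulas.

Lemma countable_inj T (A : set T) : countable [set: T] -> exists f : T -> nat, injective f.
Proof. by move=> /countable_injP[f fi]; exists f => x y; apply: fi; rewrite in_setT. Qed.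

Lemma countable_formula L V : countable_language L -> countable [set: V] ->
  countable [set: formula L V].
Proof.
move=> [/(countable_inj set0)[cf cfi] /(countable_inj set0)[cr cri]].
move=> /(countable_inj set0)[cv cvi]; apply/countable_injP.
exists (fun phi => pickle (formula_code cf cr cv phi)) => p q _ _.
by move=> /(pcan_inj pickleK)/(formula_code_inj cfi cri cvi).
Qed.

(** * Definability with parameters in one structure *)

Section OneStructure.
Variables (L : language) (N : structure L).
Implicit Types (C : set N) (V W : Type).

Definition dterm C V W (r : (V -> N) -> (W -> N)) : Prop :=
  uterm (S := fun _ : unit => N) (fun _ (b : C) => val b) (fun _ => r).

Lemma definableE C V (X : set (V -> N)) :
  definable C X <-> udef (S := fun _ : unit => N) (fun _ (b : C) => val b) (fun _ => X).
Proof.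
split=> [[phi ->]|[phi H]]; exists phi => //; apply/seteqP.
by split=> x; have := H tt x; rewrite /= => ->.
Qed.

Lemma dterm_id C V : dterm C (fun x : V -> N => x).
Proof. exact: (uterm_var _ id). Qed.

Lemma dterm_const C V W (s : W -> N) :
  (forall w, C (s w)) -> dterm C (fun _ : V -> N => s).
Proof.
move=> Cs; exists (fun w => inr (SigSub (mem_set (Cs w)) : C)) => i x.
exact: funext.
Qed.

Lemma dterm_join C V W W' (r : (V -> N) -> (W -> N)) (r' : (V -> N) -> (W' -> N)) :
  dterm C r -> dterm C r' -> dterm C (fun x => join (r x) (r' x)).
Proof. exact: uterm_join. Qed.

Lemma dterm_comp C V W W' (r : (V -> N) -> (W -> N)) (g : W' -> W) :
  dterm C r -> dterm C (fun x => r x \o g).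
Proof. exact: uterm_comp. Qed.

Lemma definable_subst C V W (X : set (W -> N)) (r : (V -> N) -> (W -> N)) :
  definable C X -> dterm C r -> definable C [set x | X (r x)].
Proof.
by move=> /definableE dX dr; apply/definableE; apply: (udef_subst dX dr).
Qed.

Lemma definable_not C V (X : set (V -> N)) :
  definable C X -> definable C [set x | ~ X x].
Proof. by move=> /definableE dX; apply/definableE; apply: (udef_not dX). Qed.

Lemma definable_True C V : definable C [set: V -> N].
Proof. by apply/definableE; apply: udef_True. Qed.

Lemma definable_imp C V (X Y : set (V -> N)) :
  definable C X -> definable C Y -> definable C [set x | X x -> Y x].
Proof.
by move=> /definableE dX /definableE dY; apply/definableE; apply: (udef_imp dX dY).
Qed.

Lemma definable_and C V (X Y : set (V -> N)) :
  definable C X -> definable C Y -> definable C [set x | X x /\ Y x].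
Proof.
by move=> /definableE dX /definableE dY; apply/definableE; apply: (udef_and dX dY).
Qed.

Lemma definable_eq C V (W : finType) (r r' : (V -> N) -> (W -> N)) :
  dterm C r -> dterm C r' -> definable C [set x | r x = r' x].
Proof. by move=> dr dr'; apply/definableE; apply: (udef_eq dr dr'). Qed.

Lemma definable_ex C V (W : finType) (P : (V -> N) -> (W -> N) -> Prop) :
  definable C [set x : V + W -> N | P (x \o inl) (x \o inr)] ->
  definable C [set x | exists y, P x y].
Proof.
move=> /definableE dP; apply/definableE.
exact: (@udef_ex _ _ _ _ _ _ _ (fun _ => P)).
Qed.

Lemma definable_mono C C' V (X : set (V -> N)) :
  C `<=` C' -> definable C X -> definable C' X.
Proof.
move=> CC' [phi ->].
pose g (b : C) : C' := SigSub (mem_set (CC' _ (set_mem (valP b)))).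
pose h (u : V + C) : V + C' := match u with inl v => inl v | inr b => inr (g b) end.
have E (x : V -> N) : join x val = join x val \o h.
  by apply: funext => -[].
by exists (formula_map h phi); apply/seteqP; split=> x; rewrite /= /realizes sat_map -E.
Qed.

Lemma countably_many_definable C (V : finType) :
  countable_language L -> countable C ->
  exists e : nat -> set (V -> N), forall X, definable C X -> exists k, e k = X.
Proof.
move=> cL cC.
have cV : countable [set: V + C].
  have [f fi] : exists f : C -> nat, injective f.
    by apply: (countable_inj set0); rewrite /countable (card_le_eql (card_setT C)).
  apply/countable_injP.
  exists (fun u => pickle (match u with inl v => inl v | inr b => inr (f b) end : V + nat)).
  move=> [v|b] [w|b'] _ _ /(pcan_inj pickleK) // [].
    by move=> ->.
  by move=> /fi->.
have [cd cdi] := countable_inj set0 (countable_formula cL cV).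
exists (fun k => xget set0 [set X | exists2 phi : formula L (V + C), cd phi = k &
  X = [set x | realizes phi x]]) => _ [phi ->]; exists (cd phi).
apply: xget_unique; first by exists phi.
by move=> X [psi /cdi-> ->].
Qed.

(** The intersection of all definable supersets is a canonical description of
    a type-definable set: the family is closed under finite intersections, so
    that compactness applies to it directly. *)
Lemma type_definableP C V (X : set (V -> N)) : type_definable C X <->
  forall x, (forall Y, definable C Y -> X `<=` Y -> Y x) -> X x.
Proof.
split=> [[Phi ->] x H phi Phi_phi|H].
  by apply: (H [set x | realizes phi x]); [exists phi|move=> y; apply].
exists [set phi : formula L (V + C) | X `<=` [set x | realizes phi x]].
apply/seteqP; split=> [x Xx phi /(_ x Xx)//|x Hx].
by apply: H => Y [phi ->] XY; apply: Hx.
Qed.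

Lemma definable_type_definable C V (X : set (V -> N)) :
  definable C X -> type_definable C X.
Proof. by move=> dX; apply/type_definableP => x; apply. Qed.

Lemma type_definable_bigcap C V T (D : set T) (F : T -> set (V -> N)) :
  (forall i, D i -> type_definable C (F i)) ->
  type_definable C [set x | forall i, D i -> F i x].
Proof.
move=> dF; apply/type_definableP => x H i Di.
have /type_definableP := dF i Di; apply=> Y dY FY.
by apply: H => // y /(_ i Di)/FY.
Qed.

Lemma type_definable_and C V (X Y : set (V -> N)) :
  type_definable C X -> type_definable C Y -> type_definable C [set x | X x /\ Y x].
Proof.
move=> dX dY.
have := @type_definable_bigcap C V bool setT (fun b => if b then X else Y).
have -> : [set x | forall b, [set: bool] b -> (if b then X else Y) x] = [set x | X x /\ Y x].
  apply/seteqP; split=> x; first by move=> H; split; [apply: (H true)|apply: (H false)].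
  by move=> [? ?] [].
by apply=> -[].
Qed.

Lemma type_definable_subst C V W (X : set (W -> N)) (r : (V -> N) -> (W -> N)) :
  type_definable C X -> dterm C r -> type_definable C [set x | X (r x)].
Proof.
move=> /type_definableP dX dr; apply/type_definableP => x H; apply: dX => Y dY XY.
by apply: (H [set x | Y (r x)]) => [|y /XY//]; apply: definable_subst dY dr.
Qed.

(** * Automorphisms *)

Lemma sat_automorphism (s : N -> N) V (phi : formula L V) : is_automorphism s ->
  forall e : V -> N, sat phi (s \o e) <-> sat phi e.
Proof.
move=> [sbij sf sr]; have sinj := bij_inj sbij.
have ev U (e : U -> N) t : eval (s \o e) t = s (eval e t).
  by elim: t => //= f args IH; rewrite sf; congr fint; apply: funext => i; apply: IH.
elim: phi => {V} [V|V t u|V R args|V p IHp q IHq|V p IH] e /=.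
- by [].
- by rewrite !ev; split=> [/sinj|->].
- rewrite (_ : (fun i => eval (s \o e) (args i)) = s \o (fun i => eval e (args i))).
    by rewrite -sr.
  by apply: funext => i; apply: ev.
- by rewrite IHp IHq.
- have E x : oapp (s \o e) (s x) = s \o oapp e x by apply: funext => -[].
  case: sbij => s' sK s'K; split=> H x; first by apply/IH; rewrite -E.
  by rewrite -(s'K x) E IH.
Qed.

Lemma Aut_definable C V (X : set (V -> N)) s x :
  Aut C s -> definable C X -> X (s \o x) <-> X x.
Proof.
move=> [sa sC] [phi ->]; rewrite /= /realizes -(sat_automorphism phi sa (join x val)).
rewrite comp_join (_ : s \o val = val) //; apply: funext => b.
by apply: sC; apply: set_mem; apply: valP.
Qed.

Lemma Aut_inv C s : Aut C s -> exists t, [/\ Aut C t, cancel s t & cancel t s].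
Proof.
move=> [[[t sK tK] sf sr] sC]; exists t; split=> //; split.
  split; first by exists s.
    move=> f x; apply: (can_inj sK); rewrite tK sf; congr fint.
    by apply: funext => i /=; rewrite tK.
  move=> r x; rewrite (sr r (t \o x)).
  by rewrite (_ : s \o (t \o x) = x) //; apply: funext => i /=; rewrite tK.
by move=> b Cb; rewrite -{1}(sC b Cb) sK.
Qed.

Lemma type_definable_invariant C V (X : set (V -> N)) :
  type_definable C X -> Defs.invariant C X.
Proof.
move=> [Phi ->] s As x; have H (phi : formula L (V + C)) : realizes phi (s \o x) <-> realizes phi x.
  by apply: (@Aut_definable C V [set y | realizes phi y] s x As); exists phi.
by split=> + phi => /(_ phi); have := H phi; tauto.
Qed.

(** * Types *)

Definition same_type C V (x y : V -> N) : Prop :=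
  forall X, definable C X -> X x -> X y.

Lemma same_type_sym C V (x y : V -> N) : same_type C x y -> same_type C y x.
Proof.
move=> xy X dX Xy; apply: contrapT => nXx.
exact: xy (definable_not dX) nXx Xy.
Qed.

Lemma type_definable_same_type C V W (r r' : (V -> N) -> (W -> N)) :
  dterm C r -> dterm C r' -> type_definable C [set x | same_type C (r x) (r' x)].
Proof.
move=> dr dr'; apply: type_definable_bigcap => X dX.
by apply: definable_type_definable; apply: definable_imp; apply: definable_subst.
Qed.

End OneStructure.

(** * Compactness and homogeneity in the monster model *)

Definition directed T (F : set (set T)) : Prop :=
  F !=set0 /\ forall X Y, F X -> F Y -> exists2 Z, F Z & Z `<=` X `&` Y.

Lemma directed_finite T (F : set (set T)) U (Q : set T -> U -> Prop) (A : set U) :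
  directed F -> finite_set A -> (forall X Y u, Y `<=` X -> Q X u -> Q Y u) ->
  (forall u, A u -> exists2 X, F X & Q X u) ->
  exists2 X, F X & forall u, A u -> Q X u.
Proof.
move=> [[X0 FX0] Fdir] /(@finite_seqP {classic U})[s ->] Qmono.
elim: s => [|u s IH] sF; first by exists X0.
have [|X FX QX] := IH; first by move=> v vs; apply: sF; rewrite /= inE [_ \in s]vs orbT.
have [|Y FY QY] := sF u; first by rewrite /= inE eqxx.
have [Z FZ ZXY] := Fdir _ _ FX FY; exists Z => // v; rewrite /= inE => /predU1P[->|vs].
  by apply: Qmono QY => z /ZXY[].
by apply: Qmono (QX v vs) => z /ZXY[].
Qed.

Section Monster.
Variables (L : language) (N : structure L) (kappa : Type).
Hypothesis kappa_large : small kappa [set: set nat].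
Hypothesis sat_N : saturated N kappa.
Hypothesis hom_N : strongly_homogeneous N kappa.

Definition compact_for (V : Type) : Prop :=
  forall (C : set N) (F : set (set (V -> N))), small kappa C -> directed F ->
  (forall X, F X -> definable C X /\ X !=set0) -> exists x, forall X, F X -> X x.

Lemma compact_unit : compact_for unit.
Proof.
move=> C F sC dF FX.
have [p0 fin_p0 p0F|x Hx] := sat_N sC
    (p := [set phi : formula L (unit + C) | F [set x | realizes phi x]]).
  have [||Z FZ Zs] := @directed_finite _ F _
      (fun X phi => forall x, X x -> realizes phi x) p0 dF fin_p0.
  - by move=> X Y phi YX XQ x /YX/XQ.
  - by move=> phi p0phi; exists [set x | realizes phi x] => //; apply: p0F.
  - by have [_ [x Zx]] := FX _ FZ; exists x => phi p0phi; apply: Zs Zx.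
exists x => X FX_; have [[phi Xphi] _] := FX _ FX_.
by rewrite Xphi; apply: Hx; rewrite /= -Xphi.
Qed.

Lemma compact_bij (V W : finType) (f : V -> W) (g : W -> V) :
  cancel f g -> cancel g f -> compact_for W -> compact_for V.
Proof.
move=> fK gK cW C F sC dF FX.
have fE (x : V -> N) : (x \o g) \o f = x by apply: funext => v /=; rewrite fK.
have gE (x : W -> N) : (x \o f) \o g = x by apply: funext => v /=; rewrite gK.
have [||x Hx] := cW C [set Y : set (W -> N) | F [set x : V -> N | Y (x \o g)]] sC.
- have [[X0 FX0] Fdir] := dF; split.
    exists [set y : W -> N | X0 (y \o f)]; rewrite /= (_ : [set _ | _] = X0) //.
    by apply/seteqP; split=> x /=; rewrite fE.
  move=> X Y FX' FY'; have [Z FZ ZXY] := Fdir _ _ FX' FY'.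
  exists [set y : W -> N | Z (y \o f)].
    by rewrite /= (_ : [set _ | _] = Z) //; apply/seteqP; split=> x /=; rewrite fE.
  by move=> y /ZXY[/=]; rewrite gE.
- move=> Y FY; have [dY [x Yx]] := FX _ FY; split; last by exists (x \o g).
  have := definable_subst dY (dterm_comp f (dterm_id C W)).
  rewrite (_ : [set _ | _] = Y) //; apply/seteqP.
  by split=> z; rewrite /= gE.
- exists (x \o f) => X FX'; apply: (Hx [set y : W -> N | X (y \o f)]).
  by rewrite /= (_ : [set _ | _] = X) //; apply/seteqP; split=> z /=; rewrite fE.
Qed.

(** Saturation gives a common point of the projections to the new coordinate;
    once it has been added to the parameters, the other coordinates remain. *)
Lemma compact_option (V : finType) : compact_for V -> compact_for (option V).
Proof.
move=> cV C F sC [[X0 FX0] Fdir] FX.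
pose pr (X : set (option V -> N)) : set (unit -> N) :=
  [set t | exists2 x, X x & x \o (fun=> None) = t].
have [||c Hc] := compact_unit (F := [set pr X | X in F]) sC.
- split; first by exists (pr X0), X0.
  move=> _ _ [X FX' <-] [Y FY' <-]; have [Z FZ ZXY] := Fdir _ _ FX' FY'.
  by exists (pr Z); [exists Z|move=> t [x /ZXY[Xx Yx] <-]; split; exists x].
- move=> _ [X FX' <-]; have [dX [x Xx]] := FX _ FX'.
  split; last by exists (x \o (fun=> None)), x.
  have := @definable_ex _ N C unit (option V) (fun t x => X x /\ x \o (fun=> None) = t).
  rewrite (_ : [set t | exists _, _] = pr X); last first.
    by apply/seteqP; split=> t; [case=> y []; exists y|case=> y Xy e; exists y].
  apply; apply: definable_and.
    exact: definable_subst dX (dterm_comp inr (dterm_id C _)).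
  apply: definable_eq; apply: dterm_comp; last exact: dterm_id.
  exact: (dterm_comp inr (dterm_id C _)).
pose C' := C `|` [set c tt].
have sC' : small kappa C' by apply: (small_setU kappa_large) => //; apply: (small_finite kappa_large); apply: finite_set1.
pose ext (y : V -> N) (v : option V) : N := if v is Some w then y w else c tt.
have [||y Hy] := cV C' [set [set y | X (ext y)] | X in F] sC'.
- split; first by exists [set y | X0 (ext y)], X0.
  move=> _ _ [X FX' <-] [Y FY' <-]; have [Z FZ ZXY] := Fdir _ _ FX' FY'.
  by exists [set y | Z (ext y)]; [exists Z|move=> y /ZXY].
- move=> _ [X FX' <-]; have [dX _] := FX _ FX'; split.
    apply: definable_subst (definable_mono (C' := C') _ dX) _; first by left.
    have C'c : C' (c tt) by right.
    exists (fun v => if v is Some w then inl w else inr (SigSub (mem_set C'c) : C')).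
    by move=> _ x; apply: funext => -[].
  have [|x Xx xc] := Hc (pr X); first by exists X.
  exists (x \o Some); rewrite /= (_ : ext _ = x) //; apply: funext => -[v//|].
  by rewrite /= -xc.
by exists (ext y) => X FX'; apply: (Hy [set y | X (ext y)]); exists X.
Qed.

Lemma compact (V : finType) : compact_for V.
Proof.
have cI k : compact_for 'I_k.
  elim: k => [|k IH].
    move=> C F sC _ FX; exists (fun=> point) => X /FX[_ [x Xx]].
    by rewrite (_ : (fun=> _) = x) //; apply: funext => -[].
  pose g (u : option 'I_k) := if u is Some i then lift ord0 i else ord0.
  apply: (@compact_bij _ _ (unlift ord0) g _ _ (compact_option IH)).
    by move=> i; rewrite /g; case: unliftP => [j ->|->].
  by move=> [j|]; rewrite /g ?liftK ?unlift_none.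
exact: (compact_bij (@enum_rankK V) (@enum_valK V) (cI _)).
Qed.

(** Strong homogeneity applies to the partial map that fixes [C] and sends [x]
    to [y]: it is well defined, and elementary, because [x] and [y] have the
    same type over [C]. *)
Lemma homogeneous C (V : finType) (x y : V -> N) : small kappa C ->
  same_type C x y -> exists2 s, Aut C s & s \o x = y.
Proof.
move=> sC xy.
pose D := C `|` range x.
have sD : small kappa D.
  apply: (small_setU kappa_large) => //; apply: (small_finite kappa_large).
  by apply: finite_image; apply: finite_finset.
have /choice[h Hh] : forall d : D, exists u : V + C, join x val u = val d.
  move=> d; have [Cd|[v _ xv]] := set_mem (valP d); last by exists (inl v).
  by exists (inr (SigSub (mem_set Cd))).
have eqxy (u u' : V + C) : join x val u = join x val u' -> join y val u = join y val u'.
  move=> e.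
  have dE : definable C [set z : V -> N | join z (val : C -> N) u = join z val u'].
    by exists (FEq (Var L u) (Var L u')).
  exact: (xy _ dE e).
have /choice[f Hf] : forall a : N, exists b : N, forall u,
    join x (val : C -> N) u = a -> b = join y val u.
  move=> a; have [[u ua]|na] := pselect (exists u, join x (val : C -> N) u = a).
    by exists (join y val u) => u' u'a; apply: eqxy; rewrite ua u'a.
  by exists a => u ua; case: na; exists u.
have fval (u : V + C) : f (join x val u) = join y val u by apply: Hf.
have [|s sa sf] := hom_N sD (f := f).
  move=> phi; have -> : (val : D -> N) = join x val \o h by apply: funext => d /=; rewrite Hh.
  have -> : f \o (join x val \o h) = join y val \o h by apply: funext => d /=; apply: fval.
  rewrite -!sat_map; split=> H.
    by apply: (xy [set z : V -> N | realizes (formula_map h phi) z]) => //; exists (formula_map h phi).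
  by apply: (same_type_sym xy (X := [set z : V -> N | realizes (formula_map h phi) z])) => //; exists (formula_map h phi).
exists s; last first.
  by apply: funext => v; rewrite /= sf; [apply: (fval (inl v))|right; exists v].
split=> // b Cb; rewrite sf; last by left.
exact: (fval (inr (SigSub (mem_set Cb)))).
Qed.

(** Over a point in the closure of the projection, the fibres of the definable
    sets around the type-definable set form a directed family of nonempty
    definable sets. *)
Lemma type_definable_ex C (V W : finType) (P : (V -> N) -> (W -> N) -> Prop) :
  small kappa C ->
  type_definable C [set x : V + W -> N | P (x \o inl) (x \o inr)] ->
  type_definable C [set x | exists y, P x y].
Proof.
move=> sC /type_definableP dP; apply/type_definableP => x Hx.
pose X := [set x : V + W -> N | P (x \o inl) (x \o inr)].
pose C' := C `|` range x.
have sC' : small kappa C'.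
  apply: (small_setU kappa_large) => //; apply: (small_finite kappa_large).
  by apply: finite_image; apply: finite_finset.
have CC' : C `<=` C' by left.
have [||y Hy] := @compact W C'
    [set Y | exists Z, [/\ definable C Z, X `<=` Z & Y = [set y | Z (join x y)]]] sC'.
- split; first by exists setT, setT; split=> //; apply: definable_True.
  move=> _ _ [Z [dZ XZ ->]] [Z' [dZ' XZ' ->]]; exists [set y | Z (join x y) /\ Z' (join x y)] => //.
  exists [set t | Z t /\ Z' t]; split=> //; first exact: definable_and.
  by move=> t Xt; split; [apply: XZ|apply: XZ'].
- move=> _ [Z [dZ XZ ->]]; split.
    apply: definable_subst (definable_mono CC' dZ) _.
    apply: dterm_join (dterm_id _ _).
    by apply: dterm_const => v; right; exists v.
  apply: (Hx [set x | exists y, Z (join x y)]).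
    apply: definable_ex; apply: definable_subst dZ _.
    by apply: dterm_join; apply: dterm_comp; apply: dterm_id.
  by move=> x' [y Py]; exists y; apply: XZ.
exists y; apply: (dP (join x y)) => Z dZ XZ.
by apply: (Hy [set y | Z (join x y)]); exists Z.
Qed.

End Monster.

(** * Groups carried by sets *)

Section GroupTheory.
Variables (T : pointedType) (K : pregroup T).
Hypothesis gK : is_group K.
Implicit Types (x y z : T) (H : set T).
Local Notation "x ** y" := (gmul K x y) (at level 40, left associativity).
Local Notation "x ^-" := (ginv K x) (at level 3, format "x ^-").
Local Notation "1" := (gone K).

Lemma g1 : gset K 1. Proof. by case: gK. Qed.

Lemma gM x y : gset K x -> gset K y -> gset K (x ** y).
Proof. by case: gK => _ + _ _ _; apply. Qed.

Lemma gA x y z : gset K x -> gset K y -> gset K z -> x ** (y ** z) = x ** y ** z.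
Proof. by case: gK => _ _ + _ _; apply. Qed.

Lemma g1l x : gset K x -> 1 ** x = x.
Proof. by case: gK => _ _ _ + _ => /(_ x) H /H[]. Qed.

Lemma g1r x : gset K x -> x ** 1 = x.
Proof. by case: gK => _ _ _ + _ => /(_ x) H /H[]. Qed.

Lemma ginv_spec x : gset K x -> [/\ gset K x^-, x ** x^- = 1 & x^- ** x = 1].
Proof.
move=> Kx; case: gK => _ _ _ _ /(_ x Kx)[y Ky [xy yx]].
have [Ki xi] : gset K x^- /\ x ** x^- = 1.
  exact: (@xgetI _ point [set y | gset K y /\ x ** y = 1] y).
suff -> : x^- = y by [].
by rewrite -(g1l Ki) -yx -gA // xi g1r.
Qed.

Lemma gV x : gset K x -> gset K x^-. Proof. by case/ginv_spec. Qed.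
Lemma gVr x : gset K x -> x ** x^- = 1. Proof. by case/ginv_spec. Qed.
Lemma gVl x : gset K x -> x^- ** x = 1. Proof. by case/ginv_spec. Qed.

Lemma gKl x y : gset K x -> gset K y -> x^- ** (x ** y) = y.
Proof. by move=> Kx Ky; rewrite gA ?gVl ?g1l //; apply: gV. Qed.

Lemma gKVl x y : gset K x -> gset K y -> x ** (x^- ** y) = y.
Proof. by move=> Kx Ky; rewrite gA ?gVr ?g1l //; apply: gV. Qed.

Lemma gKr x y : gset K x -> gset K y -> y ** x ** x^- = y.
Proof. by move=> Kx Ky; rewrite -gA ?gVr ?g1r //; apply: gV. Qed.

Lemma gIl x y z : gset K x -> gset K y -> gset K z -> x ** y = x ** z -> y = z.
Proof. by move=> Kx Ky Kz e; rewrite -(gKl Kx Ky) e gKl. Qed.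

Lemma gV_uniq x y : gset K x -> gset K y -> x ** y = 1 -> y = x^-.
Proof. by move=> Kx Ky e; apply: (gIl Kx) => //; [apply: gV|rewrite gVr]. Qed.

Lemma gVM x y : gset K x -> gset K y -> (x ** y)^- = y^- ** x^-.
Proof.
move=> Kx Ky; apply/esym/gV_uniq; [exact: gM|by apply: gM; apply: gV|].
by rewrite gA ?gKr ?gVr //; try apply: gV => //; apply: gM.
Qed.

Lemma gVV x : gset K x -> x^-^- = x.
Proof. by move=> Kx; apply/esym/gV_uniq; [apply: gV| |apply: gVl]. Qed.

Lemma gV1 : 1^- = 1.
Proof. by apply/esym/gV_uniq; [exact: g1|exact: g1|apply/g1l/g1]. Qed.

Lemma is_subgroupP H : is_subgroup K H <->
  [/\ H `<=` K, H 1, forall x y, H x -> H y -> H (x ** y) & forall x, H x -> H x^-].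
Proof.
split=> [[HK [H1 HM _ _ HV]]|[HK H1 HM HV]]; split=> //.
  move=> x Hx; have [y Hy [xy _]] := HV x Hx.
  by rewrite -(gV_uniq (HK _ Hx) (HK _ Hy) xy).
split=> // [x y z Hx Hy Hz|x Hx|x Hx]; first by apply: gA; apply: HK.
  by split; [apply: g1l|apply: g1r]; apply: HK.
by exists x^-; [apply: HV|split; [apply: gVr|apply: gVl]; apply: HK].
Qed.

Lemma is_subgroup_full : is_subgroup K (gset K).
Proof. by apply/is_subgroupP; split=> //; [apply: g1|apply: gM|apply: gV]. Qed.

Lemma coset_eqP H x y : is_subgroup K H -> gset K x -> gset K y ->
  coset K H x = coset K H y <-> H (x^- ** y).
Proof.
move=> /is_subgroupP[HK H1 HM HV] Kx Ky; split=> [E|Hxy].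
  have : coset K H y y by exists 1; rewrite ?g1r.
  by rewrite -E => -[z Hz <-]; rewrite gKl //; apply: HK.
apply/seteqP; split=> _ [z Hz <-].
  exists ((x^- ** y)^- ** z); first by apply: HM => //; apply: HV.
  have Kz := HK _ Hz; have Kv := gV Kx; have Kvy := gV Ky.
  by rewrite gVM // gVV // !gA // ?gVr ?g1l //; apply: gM.
exists ((x^- ** y) ** z); first exact: HM.
by have Kz := HK _ Hz; have Kv := gV Kx; rewrite !gA ?gVr ?g1l //; apply: gM.
Qed.

(** All bounds on indices come from invariants of elements that determine their
    cosets and take few values. *)
Lemma bounded_index_map kappa U (J : set U) (phi : T -> U) H :
  is_subgroup K H -> small kappa J -> (forall x, gset K x -> J (phi x)) ->
  (forall x y, gset K x -> gset K y -> phi x = phi y -> H (x^- ** y)) ->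
  bounded_index kappa K H.
Proof.
move=> sH sJ Jphi Hphi; apply: small_le sJ.
apply: (@card_le_rel _ _ _ _ (fun X u => exists x, [/\ gset K x, coset K H x = X & phi x = u])).
  by move=> _ [x Kx <-]; exists (phi x); [apply: Jphi|exists x].
move=> _ _ u _ _ [x [Kx <- <-]] [y [Ky <- e]].
by apply/coset_eqP => //; apply: Hphi.
Qed.

Lemma is_subgroupI H H' : is_subgroup K H -> is_subgroup K H' -> is_subgroup K (H `&` H').
Proof.
move=> /is_subgroupP[HK H1 HM HV] /is_subgroupP[HK' H1' HM' HV'].
apply/is_subgroupP; split=> [x [/HK]//||x y [Hx Hx'] [Hy Hy']|x [Hx Hx']].
- by [].
- by split; [apply: HM|apply: HM'].
- by split; [apply: HV|apply: HV'].
Qed.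

Lemma bounded_indexI kappa H H' : small kappa [set: set nat] ->
  is_subgroup K H -> is_subgroup K H' ->
  bounded_index kappa K H -> bounded_index kappa K H' -> bounded_index kappa K (H `&` H').
Proof.
move=> kl sH sH' bH bH'.
apply: (bounded_index_map (phi := fun x => (coset K H x, coset K H' x))
  (is_subgroupI sH sH') (small_setX kl bH bH')).
  by move=> x Kx; split; exists x.
by move=> x y Kx Ky [/(coset_eqP sH Kx Ky) ? /(coset_eqP sH' Kx Ky) ?].
Qed.

Definition mulset (X Y : set T) : set T :=
  [set z | exists x y, [/\ X x, Y y & z = x ** y]].

Fixpoint powset (X : set T) (k : nat) : set T :=
  if k is k'.+1 then mulset X (powset X k') else [set 1].

Section Powers.
Variable X : set T.
Hypotheses (XK : X `<=` K) (X1 : X 1) (XV : forall x, X x -> X x^-).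

Lemma powset_sub k : powset X k `<=` K.
Proof.
elim: k => [x ->|k IH _ [x [y [Xx Yy ->]]]]; first exact: g1.
by apply: gM; [apply: XK|apply: IH].
Qed.

Lemma powsetM k l x y : powset X k x -> powset X l y -> powset X (k + l) (x ** y).
Proof.
elim: k x => [x -> Hy|k IH _ [x [z [Xx Hz ->]]] Hy].
  by rewrite g1l //; apply: powset_sub Hy.
exists x, (z ** y); split=> //; first exact: IH.
by rewrite gA //; [apply: XK|apply: powset_sub Hz|apply: powset_sub Hy].
Qed.

Lemma powset1 x : X x -> powset X 1%N x.
Proof. by move=> Xx; exists x, 1; rewrite g1r //; apply: XK. Qed.

Lemma powset_mono k l : (k <= l)%N -> powset X k `<=` powset X l.
Proof.
move=> /subnK<-; elim: (l - k)%N => //= j IH x /IH Hx.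
by exists 1, x; split=> //; rewrite g1l //; apply: powset_sub Hx.
Qed.

Lemma powsetV k x : powset X k x -> powset X k x^-.
Proof.
elim: k x => [x ->|k IH _ [x [y [Xx Hy ->]]]]; first by rewrite gV1.
rewrite gVM; [|exact: XK|exact: powset_sub Hy].
by rewrite -addn1; apply: powsetM; [apply: IH|apply/powset1/XV].
Qed.

Lemma is_subgroup_powers : is_subgroup K (\bigcup_k powset X k).
Proof.
apply/is_subgroupP; split=> [x [k _ /powset_sub]//||x y [k _ Hx] [l _ Hy]|x [k _ Hx]].
- by exists 0%N.
- by exists (k + l)%N => //; apply: powsetM.
- by exists k => //; apply: powsetV.
Qed.

End Powers.

End GroupTheory.

(** Reduces membership of products and inverses in a group to that of their factors. *)
Ltac gin := repeat first [eassumption | apply: gM | apply: gV | apply: g1].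

(** Associativity is the cocycle identity; the left inverse of [(a, g)] is a
    right inverse by the cocycle identity at [(g, g^-1, g)]. *)
Lemma is_group_extension (T : pointedType) U V (G : pregroup (V -> T))
    (A : pregroup (U -> T)) act h :
  is_group G -> is_abelian_group A -> acts_by_automorphisms G A act ->
  is_cocycle G A act h -> is_group (extension G A act h).
Proof.
move=> gG [gA_ cA] [actA act1 actM actD] [hA hcoc hn].
have g1G := g1 gG; have g1A := g1 gA_.
have h1l g : gset G g -> h (gone G) g = gone A by move=> /hn[].
have h1r g : gset G g -> h g (gone G) = gone A by move=> /hn[].
have act0 g : gset G g -> act g (gone A) = gone A.
  move=> Gg; have aA := actA _ _ Gg g1A.
  apply: (gIl gA_ aA) => //; rewrite -actD // !g1r //.
have mA := gM gA_; have mG := gM gG.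
split.
- by exists (gone A) => //; exists (gone G).
- move=> _ _ [a Aa [g Gg <-]] [b Ab [k Gk <-]] /=.
  exists (gmul A (gmul A a (act g b)) (h g k)); first (gin; auto).
  by exists (gmul G g k) => //; gin.
- move=> _ _ _ [a Aa [g Gg <-]] [b Ab [k Gk <-]] [d Ad [l Gl <-]] /=.
  rewrite !join_inl !join_inr (gA gG) //; congr join.
  have Agk := hA _ _ Gg Gk; have Akl := hA _ _ Gk Gl.
  have Hgb := actA _ _ Gg Ab; have Hkd := actA _ _ Gk Ad.
  have Hgkd := actA _ _ Gg Hkd; have Hgkl := actA _ _ Gg Akl.
  have Hgk_l := hA _ _ (mG _ _ Gg Gk) Gl; have Hg_kl := hA _ _ Gg (mG _ _ Gk Gl).
  rewrite !actD //; try by gin.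
  rewrite actM // -!(gA gA_); try by gin.
  congr gmul; congr gmul.
  have swap x y z : gset A x -> gset A y -> gset A z ->
      gmul A x (gmul A y z) = gmul A y (gmul A x z).
    by move=> Ax Ay Az; rewrite !(gA gA_) // (cA x).
  rewrite [RHS]swap //; congr gmul; rewrite hcoc //.
  by rewrite (cA (act g (h k l))).
- move=> _ [a Aa [g Gg <-]] /=; rewrite !join_inl !join_inr.
  rewrite act1 // act0 // h1l // h1r // !(g1l gG, g1r gG, g1l gA_, g1r gA_) //.
- move=> _ [a Aa [g Gg <-]] /=.
  have Gv := gV gG Gg; have Av := gV gA_ Aa.
  have Hh := hA _ _ Gg Gv; have Hh' := hA _ _ Gv Gg.
  pose b := ginv A (gmul A (act (ginv G g) a) (h (ginv G g) g)).
  have Hva := actA _ _ Gv Aa.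
  have Ab : gset A b by gin.
  exists (join b (ginv G g)); first by exists b => //; exists (ginv G g).
  rewrite /= !join_inl !join_inr (gVr gG) // (gVl gG) //.
  have E : gmul A (gmul A b (act (ginv G g) a)) (h (ginv G g) g) = gone A.
    by rewrite -(gA gA_) // gVl //; gin.
  split; congr join => //.
  have Hgb := actA _ _ Gg Ab.
  have E2 : act g (gmul A (gmul A b (act (ginv G g) a)) (h (ginv G g) g)) = gone A.
    by rewrite E act0.
  have Hg : act g (act (ginv G g) a) = a by rewrite -actM // gVr // act1.
  rewrite !actD // in E2; last by gin.
  rewrite Hg in E2.
  have := hcoc _ _ _ Gg Gv Gg; rewrite (gVr gG) // (gVl gG) // h1l // h1r //.
  rewrite (g1r gA_) // (g1l gA_); last exact: actA.
  by move=> ->; rewrite (cA a).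
Qed.

(** * Maximal translation-invariant filters *)

Section MaximalFilter.
Variables (T : pointedType) (K : pregroup T) (P : set T).
Hypothesis (gK : is_group K) (sP : is_subgroup K P).
Local Notation "x ** y" := (gmul K x y) (at level 40, left associativity).

Definition invariant_filter (F : set (set T)) : Prop :=
  [/\ forall A B, F A -> F B -> F (A `&` B),
      forall A B, F A -> A `&` P `<=` B -> F B,
      forall A, F A -> A `&` P !=set0
    & forall g A, P g -> F A -> F [set x | A (g ** x)]].

(** Such a filter is a minimal closed invariant set of ultrafilters on [P], and
    the last clause says that finitely many translates of a clopen set
    [A] that meets it cover it. *)
Lemma maximal_invariant_filter : exists F,
  [/\ invariant_filter F, F setT & forall A, ~ F (~` A) ->
    exists2 s : seq T, {in s, forall g, P g} & F [set x | exists2 g, g \in s & A (g ** x)]].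
Proof.
have [PK P1 PM PV] := (is_subgroupP gK P).1 sP.
have [F0 F0Q totF|F [FQ Fmax]] := @Zorn_bigcup _ invariant_filter.
  split.
  - move=> A B [X FX XA] [Y FY YB].
    have [XY|YX] := totF _ _ FX FY.
      by exists Y => //; have [+ _ _ _] := F0Q _ FY; apply=> //; apply: XY.
    by exists X => //; have [+ _ _ _] := F0Q _ FX; apply=> //; apply: YX.
  - by move=> A B [X FX XA] AB; exists X => //; have [_ + _ _] := F0Q _ FX; apply; eauto.
  - by move=> A [X FX XA]; have [_ _ + _] := F0Q _ FX; apply.
  - by move=> g A Pg [X FX XA]; exists X => //; have [_ _ _] := F0Q _ FX; apply.
have [FI FS Fne Fg] := FQ.
have FT : F setT.
  apply: contrapT => nFT; have F_0 A : ~ F A.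
    by move=> FA; apply: nFT; apply: FS FA _.
  apply: (Fmax [set A | P `<=` A]).
    rewrite properEneq; split; last by move=> A /F_0.
    by apply/eqP => E; apply: nFT; rewrite E.
  split.
  - by move=> A B PA PB x Px; split; [apply: PA|apply: PB].
  - by move=> A B PA AB x Px; apply: AB; split=> //; apply: PA.
  - by move=> A PA; exists (gone K); split=> //; apply: PA.
  - by move=> g A Pg PA x Px; apply/PA/PM.
exists F; split=> // A nFA.
pose gen B := exists C (s : seq T), [/\ F C, {in s, forall g, P g} &
  C `&` P `&` [set x | forall g, g \in s -> ~ A (g ** x)] `<=` B].
have [[B [[C [s [FC sP' CB]]] BP]]|ngen] :=
    pselect (exists B, gen B /\ ~ (B `&` P !=set0)).
  exists s => //; apply: FS FC _ => x [Cx Px]; apply: contrapT => nA.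
  apply: BP; exists x; split=> //; apply: CB; split=> // g gs Agx.
  by apply: nA; exists g.
case: (Fmax gen).
  rewrite properEneq; split.
    apply/eqP => E; apply: nFA; rewrite E; exists setT, [:: gone K]; split=> //.
      by move=> g; rewrite inE => /eqP->.
    move=> x [[_ Px] /(_ (gone K))]; rewrite (g1l gK); last exact: PK.
    by apply; rewrite inE.
  by move=> B FB; exists B, [::]; split=> // x [[]].
split.
- move=> B B' [C [s [FC sP' CB]]] [C' [s' [FC' sP'' CB']]].
  exists (C `&` C'), (s ++ s'); split; first exact: FI.
    by move=> g; rewrite mem_cat => /orP[/sP'|/sP''].
  move=> x [[[Cx C'x] Px] H]; split; [apply: CB|apply: CB']; split=> //= g gs;
  by apply: H; rewrite mem_cat gs ?orbT.
- move=> B B' [C [s [FC sP' CB]]] BB'; exists C, s; split=> // x Hx.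
  by apply: BB'; split; [apply: CB|case: Hx => -[]].
- by move=> B gB; apply: contrapT => nB; apply: ngen; exists B.
- move=> g B Pg [C [s [FC sP' CB]]].
  exists [set x | C (g ** x)], [seq k ** g | k <- s]; split; first exact: Fg.
    by move=> _ /mapP[k /sP' Pk ->]; apply: PM.
  move=> x [[Cx Px] H]; apply: CB; split=> [|k ks]; first by split=> //; apply: PM.
  rewrite (gA gK); try by apply: PK => //; apply: sP'.
  by apply: H; apply/mapP; exists k.
Qed.

End MaximalFilter.

(** * Definable groups in the monster model *)

Lemma graph2P L (M : structure L) U V W (X : set (U -> M)) (Y : set (V -> M))
    (f : (U -> M) -> (V -> M) -> (W -> M)) x y z :
  graph2 X Y f (join (join x y) z) <-> [/\ X x, Y y & z = f x y].
Proof.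
split=> [[a Xa [b Yb /join_inj[/join_inj[<- <-] <-]]]|[Xx Yy ->]] //.
by exists x => //; exists y.
Qed.

Section DefinableGroup.
Variables (L : language) (N : structure L) (kappa : Type).
Hypothesis kappa_large : small kappa [set: set nat].
Hypothesis sat_N : saturated N kappa.
Variables (C : set N) (V : finType) (K : pregroup (V -> N)).
Hypotheses (small_C : small kappa C) (gK : is_group K) (dK : definable_group C K).
Local Notation "x ** y" := (gmul K x y) (at level 40, left associativity).
Local Notation "x ^-" := (ginv K x) (at level 3, format "x ^-").
Local Notation "1" := (gone K).
Local Notation Kgraph := (graph2 K K (gmul K)).

Lemma type_definable_mulset X Y : X `<=` K -> Y `<=` K ->
  type_definable C X -> type_definable C Y -> type_definable C (mulset K X Y).
Proof.
move=> XK YK tX tY.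
have -> : mulset K X Y = [set z | exists x y, (X x /\ Y y) /\ Kgraph (join (join x y) z)].
  apply/seteqP; split=> z [x [y]].
    by move=> [Xx Yy ->]; exists x, y; split=> //; apply/graph2P; split; auto.
  by move=> [[Xx Yy] /graph2P[_ _ ->]]; exists x, y.
do 2! apply: (type_definable_ex kappa_large sat_N small_C) => //=.
apply: type_definable_and; first apply: type_definable_and.
- exact: (type_definable_subst tX (dterm_comp inr (dterm_comp inl (dterm_id C _)))).
- exact: (type_definable_subst tY (dterm_comp inr (dterm_id C _))).
- apply: definable_type_definable; apply: (definable_subst dK.2).
  apply: dterm_join; last exact: (dterm_comp inl (dterm_comp inl (dterm_id C _))).
  apply: dterm_join; first exact: (dterm_comp inr (dterm_comp inl (dterm_id C _))).
  exact: (dterm_comp inr (dterm_id C _)).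
Qed.

Lemma definable_gone : definable C [set 1].
Proof.
have -> : [set 1] = [set x | Kgraph (join (join x x) x)].
  apply/seteqP; split=> x.
    by move=> ->; apply/graph2P; split; rewrite ?g1l //; apply: g1.
  move=> /graph2P[Kx _ e]; apply: (gIl gK Kx) => //; first exact: g1.
  by rewrite g1r.
by apply: (definable_subst dK.2); do 2? apply: dterm_join; apply: dterm_id.
Qed.

Lemma type_definable_powset X k : X `<=` K -> X 1 ->
  type_definable C X -> type_definable C (powset K X k).
Proof.
move=> XK X1 tX; elim: k => [|k IH].
  exact/definable_type_definable/definable_gone.
by apply: type_definable_mulset => //; apply: powset_sub.
Qed.

Lemma definable_translate (C' : set N) (s : V -> N) (X : set (V -> N)) : C `<=` C' -> (forall v, C' (s v)) -> gset K s ->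
  definable C' X -> definable C' [set x | gset K x /\ X (s ** x)].
Proof.
move=> CC' C's Ks dX.
have -> : [set x | gset K x /\ X (s ** x)] = [set x | exists z, Kgraph (join (join s x) z) /\ X z].
  apply/seteqP; split=> x.
    by move=> [Kx Xsx]; exists (s ** x); split=> //; apply/graph2P.
  by move=> [z [/graph2P[_ Kx ->]]].
apply: definable_ex; apply: definable_and.
  apply: (definable_subst (definable_mono CC' dK.2)).
  apply: dterm_join; last exact: (dterm_comp inr (dterm_id _ _)).
  apply: dterm_join; last exact: (dterm_comp inl (dterm_id _ _)).
  exact: dterm_const.
exact: (definable_subst dX (dterm_comp inr (dterm_id _ _))).
Qed.

(** If a type-definable group is the union of an increasing sequence of
    type-definable pieces [X k] that is compatible with the group operations,
    then it is equal to one of them.  By Baire category some definable set,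
    positive for a maximal invariant filter, is essentially contained in [X k];
    finitely many translates of it cover almost all of the group, and so do
    the same translates of any definable [chi] containing [X k].  For each [g]
    this cover meets its own translate by [g], and by compactness so do the
    translates of [X k] itself. *)
Section Newelski.
Variables (P : set (V -> N)) (X : nat -> set (V -> N)).
Hypotheses (sP : is_subgroup K P) (tP : type_definable C P).
Hypothesis tX : forall k, type_definable C (X k).
Hypotheses (PX : forall x, P x -> exists k, X k x).
Hypotheses (XM : forall k l x y, X k x -> X l y -> X (k + l) (x ** y)).
Hypotheses (XV : forall k x, X k x -> X k x^-).
Hypotheses (Xmono : forall k l, (k <= l)%N -> X k `<=` X l).

Let positive (F : set (set (V -> N))) A := ~ F (~` A).

Lemma Baire_positive F : invariant_filter K P F -> F setT ->
  exists k psi, [/\ definable C psi, positive F psi & forall chi,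
    definable C chi -> X k `<=` chi -> F (~` (psi `\` chi))].
Proof.
move=> [FI FS Fne Fg] FT; apply: contrapT => H.
have H' (t : nat * set (V -> N)) : exists chi, definable C t.2 -> positive F t.2 ->
    [/\ definable C chi, X t.1 `<=` chi & positive F (t.2 `\` chi)].
  apply: contrapT => nchi; apply: H; exists t.1, t.2.
  have [dt|nd] := pselect (definable C t.2); last by case: nchi; exists setT => /nd.
  have [pt|np] := pselect (positive F t.2); last by case: nchi; exists setT => _ /np.
  split=> // chi dchi Xchi; apply: contrapT => nF; apply: nchi.
  by exists chi => _ _; split.
have [ch Hch] := choice H'.
(* [psi k] decreases, stays positive, and [psi k.+1] avoids [X k]. *)
pose psi := fix psi k := if k is k'.+1 then psi k' `\` ch (k', psi k') else setT.
have Hpsi k : definable C (psi k) /\ positive F (psi k).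
  elim: k => [|k [dk pk]].
    split; first exact: definable_True.
    by move=> /Fne[x []]; rewrite setCT.
  have [dch _ pos] := Hch (k, psi k) dk pk; split=> //.
  exact: definable_and dk (definable_not dch).
have mono k l : (k <= l)%N -> psi l `<=` psi k.
  by move=> /subnK<-; elim: (l - k)%N => //= i IH x [/IH].
have [||x Hx] := @compact _ _ _ kappa_large sat_N V C
    [set Y | exists Z k, [/\ definable C Z, P `<=` Z & Y = Z `&` psi k]] small_C.
- split; first by exists (setT `&` psi 0%N), setT, 0%N; split=> //; apply: definable_True.
  move=> _ _ [Z [k [dZ PZ ->]]] [Z' [k' [dZ' PZ' ->]]].
  exists ((Z `&` Z') `&` psi (maxn k k')).
    exists (Z `&` Z'), (maxn k k'); split=> //; first exact: definable_and.
    by move=> x Px; split; [apply: PZ|apply: PZ'].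
  move=> x [[Zx Z'x] px]; split; split=> //; apply: mono px; first exact: leq_maxl.
  exact: leq_maxr.
- move=> _ [Z [k [dZ PZ ->]]]; have [dk pk] := Hpsi k; split; first exact: definable_and.
  apply: contrapT => nZ; apply: pk; apply: FS FT _ => x [_ Px] px.
  by apply: nZ; exists x; split=> //; apply: PZ.
have Px : P x.
  have /type_definableP := tP; apply=> Z dZ PZ.
  by have [] : (Z `&` psi 0%N) x by apply: Hx; exists Z, 0%N.
have [k Xx] := PX Px.
have [_ [_ nch]] : (setT `&` psi k.+1) x.
  by apply: Hx; exists setT, k.+1; split=> //; apply: definable_True.
by have [dk pk] := Hpsi k; have [_ Xch _] := Hch (k, psi k) dk pk; apply/nch/Xch.
Qed.

Lemma finitely_many_steps : exists k, P `<=` X k.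
Proof.
have [PK P1 PM PV] := (is_subgroupP gK P).1 sP.
have [F [Finv FT Fsyn]] := maximal_invariant_filter gK sP.
have [k [psi [dpsi ppsi Hpsi]]] := Baire_positive Finv FT.
have [s sP' Fs] := Fsyn _ ppsi; have [FI FS Fne Fg] := Finv.
have [l sX] : exists l, {in s, forall g, X l g}.
  elim: s sP' {Fs} => [|g s IH] sP'; first by exists 0%N.
  have [|l Hl] := IH; first by move=> x xs; apply: sP'; rewrite inE xs orbT.
  have [l' Hl'] : exists l', X l' g by apply/PX/sP'; rewrite inE eqxx.
  exists (maxn l' l) => x; rewrite inE => /predU1P[->|/Hl].
    by apply: Xmono Hl'; apply: leq_maxl.
  by apply: Xmono; apply: leq_maxr.
(* The translates by [s] of any definable set around [X k] still cover almost
   everything, since [psi] exceeds such a set by a set that is not positive. *)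
have Fchi chi : definable C chi -> X k `<=` chi ->
    F [set x | exists2 g, g \in s & chi (g ** x)].
  move=> dchi Xchi; have Fc := Hpsi chi dchi Xchi.
  have Fall (r : seq (V -> N)) : {in r, forall g, P g} ->
      F [set x | forall g, g \in r -> ~ (psi `\` chi) (g ** x)].
    elim: r => [|g r IH] rP; first by apply: FS FT _.
    apply: FS (FI _ _ (Fg g _ _ Fc) (IH _)) _.
    - by apply: rP; rewrite inE eqxx.
    - by move=> x xr; apply: rP; rewrite inE xr orbT.
    - by move=> x [[H1 H2] _] a; rewrite inE => /predU1P[->|ar]; [exact: H1|exact: H2].
  apply: FS (FI _ _ Fs (Fall s sP')) _ => x [[[g gs pg] H] _].
  by exists g => //; apply: contrapT => nchi; apply: (H g gs); split.
exists (l + k + (k + l))%N => g Pg.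
(* By directedness one pair of translations works for all [chi] at once. *)
have [a [b [sa sb Hab]]] : exists a b, [/\ a \in s, b \in s &
    forall chi, definable C chi -> X k `<=` chi ->
      exists2 x, P x & chi (a ** x) /\ chi (b ** (g ** x))].
  pose D := [set chi | definable C chi /\ X k `<=` chi].
  have dirD : directed D.
    split; first by exists setT; split=> //; apply: definable_True.
    move=> chi chi' [d1 X1] [d2 X2]; exists (chi `&` chi') => //.
    by split; [apply: definable_and|move=> x Xx; split; [apply: X1|apply: X2]].
  apply: contrapT => nab.
  have [||chi [dchi Xchi] Hchi] := @directed_finite _ D _
      (fun chi (p : (V -> N) * (V -> N)) => ~ exists2 x, P x & chi (p.1 ** x) /\ chi (p.2 ** (g ** x)))
      ([set` s] `*` [set` s]) dirD (finite_setX (finite_seq s) (finite_seq s)).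
  - by move=> chi chi' p sub nex [x Px [c1 c2]]; apply: nex; exists x => //; split; apply: sub.
  - move=> [a b] [/= sa sb]; apply: contrapT => H; apply: nab; exists a, b; split=> // chi d1 X1.
    by apply: contrapT => nx; apply: H; exists chi.
  - have Fc := Fchi chi dchi Xchi.
    have [x [[[a sa ca] [b sb cb]] Px]] := Fne _ (FI _ _ Fc (Fg g _ Pg Fc)).
    by apply: (Hchi (a, b)) => //; exists x.
have Pa := sP' _ sa; have Pb := sP' _ sb; have Ka := PK _ Pa; have Kb := PK _ Pb.
have Kg := PK _ Pg; have Pbg := PM _ _ Pb Pg; have Kbg := PK _ Pbg.
pose C' := C `|` (range a `|` range (b ** g)).
have CC' : C `<=` C' by left.
have C'a v : C' (a v) by right; left; exists v.
have C'bg v : C' ((b ** g) v) by right; right; exists v.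
have sC' : small kappa C'.
  apply: (small_setU kappa_large) => //; apply: (small_finite kappa_large).
  by rewrite finite_setU; split; apply: finite_image; apply: finite_finset.
have [||x Hx] := @compact _ _ _ kappa_large sat_N V C'
    [set Y | exists Z chi, [/\ definable C Z /\ P `<=` Z, definable C chi /\ X k `<=` chi &
      Y = [set x | Z x /\ ((gset K x /\ chi (a ** x)) /\ (gset K x /\ chi ((b ** g) ** x)))]]] sC'.
- split.
    eexists; exists setT, setT; split; last reflexivity; split=> //; exact: definable_True.
  move=> _ _ [Z [c [[dZ PZ] [dc Xc] ->]]] [Z' [c' [[dZ' PZ'] [dc' Xc'] ->]]].
  exists [set x | (Z `&` Z') x /\ ((gset K x /\ (c `&` c') (a ** x)) /\
      (gset K x /\ (c `&` c') ((b ** g) ** x)))].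
    exists (Z `&` Z'), (c `&` c'); split=> //; split; first exact: definable_and.
    + by move=> x Px; split; [apply: PZ|apply: PZ'].
    + exact: definable_and.
    + by move=> x Px; split; [apply: Xc|apply: Xc'].
  by move=> x [[? ?] [[? [? ?]] [? [? ?]]]].
- move=> _ [Z [c [[dZ PZ] [dc Xc] ->]]]; split.
    apply: definable_and; first exact: definable_mono CC' dZ.
    have dc' := definable_mono CC' dc.
    by apply: definable_and; apply: definable_translate.
  have [x Px [c1 c2]] := Hab c dc Xc; exists x; split; first exact: PZ.
  by have Kx := PK _ Px; rewrite -(gA gK) //.
have [Kx Xax Xbgx] : [/\ gset K x, X k (a ** x) & X k ((b ** g) ** x)].
  have Hc c : definable C c -> X k `<=` c ->
      [/\ gset K x, c (a ** x) & c ((b ** g) ** x)].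
    move=> dc Xc; have [|_ [[? ?] [? ?]]] := Hx [set x | setT x /\
        ((gset K x /\ c (a ** x)) /\ (gset K x /\ c ((b ** g) ** x)))]; last by split.
    by exists setT, c; split=> //; split=> //; apply: definable_True.
  split; first by have [] := Hc setT (definable_True C V).
    by have /type_definableP := tX k; apply=> c dc Xc; have [] := Hc c dc Xc.
  by have /type_definableP := tX k; apply=> c dc Xc; have [] := Hc c dc Xc.
have -> : g = (b^- ** ((b ** g) ** x)) ** ((a ** x)^- ** a).
  have Kv := gV gK Kx; have Kva := gV gK Ka; have Kbv := gV gK Kb.
  rewrite (gVM gK) // -!(gA gK) //; try by gin.
  by rewrite gVl // g1r // gVr // g1r // gKl.
apply: XM; apply: XM => //; first by apply/XV/sX.
- exact: XV.
- exact: sX.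
Qed.

End Newelski.

End DefinableGroup.

(** * The connected component has bounded index *)

Section BoundedConn00.
Variables (L : language) (N : structure L) (kappa : Type).
Hypothesis kappa_large : small kappa [set: set nat].
Hypothesis sat_N : saturated N kappa.
Variables (C : set N) (V : finType) (K : pregroup (V -> N)).
Hypotheses (small_C : small kappa C) (gK : is_group K) (dK : definable_group C K).
Local Notation "x ** y" := (gmul K x y) (at level 40, left associativity).
Local Notation "x ^-" := (ginv K x) (at level 3, format "x ^-").
Local Notation "1" := (gone K).
Local Notation Kgraph := (graph2 K K (gmul K)).

Lemma small_coordinates (R : set (V -> N)) :
  small kappa R -> small kappa [set a | exists2 r, R r & range r a].
Proof.
move=> sR; pose f (p : (V -> N) * V) := p.1 p.2.
have sV : small kappa [set: V].
  by apply: (small_finite kappa_large); apply: finite_finset.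
apply: (small_sub (@small_image kappa _ _ f _ (small_setX kappa_large sR sV))).
by move=> _ [r Rr [v _ <-]]; exists (r, v).
Qed.

Lemma definable_quotient chi : definable C chi ->
  definable C [set t : V + V -> N | [/\ gset K (t \o inl), gset K (t \o inr)
    & chi ((t \o inl)^- ** (t \o inr))]].
Proof.
move=> dchi.
have -> : [set t : V + V -> N | [/\ gset K (t \o inl), gset K (t \o inr)
    & chi ((t \o inl)^- ** (t \o inr))]] =
  [set t : V + V -> N | exists z, Kgraph (join (join (t \o inl) z) (t \o inr)) /\ chi z].
  apply/seteqP; split=> t.
    move=> [Kl Kr ch]; exists ((t \o inl)^- ** (t \o inr)); split=> //.
    by apply/graph2P; split=> //; [gin|rewrite gKVl].
  by move=> [z [/graph2P[Kl Kz e] ch]]; rewrite /= e gKl //; split=> //; gin.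
apply: definable_ex; apply: definable_and.
  apply: (definable_subst dK.2); apply: dterm_join.
    apply: dterm_join; last exact: (dterm_comp inr (dterm_id _ _)).
    exact: (dterm_comp inl (dterm_comp inl (dterm_id _ _))).
  exact: (dterm_comp inr (dterm_comp inl (dterm_id _ _))).
exact: (definable_subst dchi (dterm_comp inr (dterm_id _ _))).
Qed.

(** A maximal set of elements whose quotients avoid [chi] is small, because its
    elements lie in distinct cosets of [H]; if it were infinite, saturation
    would provide one more element. *)
Lemma finite_net H chi : is_subgroup K H -> bounded_index kappa K H ->
  definable C chi -> H `<=` chi ->
  exists R, [/\ finite_set R, R `<=` K &
    forall x, gset K x -> exists2 r, R r & chi (r^- ** x)].
Proof.
move=> sH bH dchi Hchi; have [HK H1 HM HV] := (is_subgroupP gK H).1 sH.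
pose near x y := chi (x^- ** y) /\ chi (y^- ** x).
pose anti R := R `<=` K /\ forall x y, R x -> R y -> near x y -> x = y.
have [F FQ totF|R [[RK Ra] Rmax]] := @Zorn_bigcup _ anti.
  split=> [x [X /FQ[XK _]]|x y [X FX Xx] [Y FY Yy]]; first exact: XK.
  have [XY|YX] := totF _ _ FX FY.
    by have [_] := FQ _ FY; apply=> //; apply: XY.
  by have [_] := FQ _ FX; apply=> //; apply: YX.
have near_refl x : gset K x -> near x x by move=> Kx; split; rewrite gVl //; apply: Hchi.
have net x : gset K x -> exists2 r, R r & near r x.
  move=> Kx; apply: contrapT => nr; apply: (Rmax (R `|` [set x])).
    rewrite properEneq; split; last by left.
    apply/eqP => E; apply: nr; exists x; last exact: near_refl.
    by rewrite E; right.
  split=> [y [/RK//|->//]|y z [Ry|->] [Rz|->] nyz] //; first exact: Ra.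
    by case: nr; exists y.
  by case: nr; exists z => //; case: nyz.
exists R; split=> // [|x /net[r Rr [n1 _]]]; last by exists r.
apply: contrapT => infR.
have sR : small kappa R.
  apply: small_le bH; apply: (@card_le_rel _ _ _ _ (fun r X => coset K H r = X)).
    by move=> r Rr; exists (coset K H r) => //; exists r => //; apply: RK.
  move=> x y X Rx Ry <- /esym E; have Kx := RK _ Rx; have Ky := RK _ Ry.
  apply: Ra => //; split; apply: Hchi; first exact/(coset_eqP gK).
  by apply/(coset_eqP gK).
pose C' := C `|` [set a | exists2 r, R r & range r a].
have sC' : small kappa C'.
  by apply: (small_setU kappa_large) => //; apply: small_coordinates.
have CC' : C `<=` C' by left.
have [||x Hx] := @compact _ _ _ kappa_large sat_N V C'
    [set Y | definable C' Y /\ finite_set (R `\` Y)] sC'.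
- split.
    by exists setT; split; [exact: definable_True|rewrite setDT; apply: finite_set0].
  move=> X Y [dX fX] [dY fY]; exists (X `&` Y) => //; split; first exact: definable_and.
  by rewrite setDIr finite_setU.
- move=> Y [dY fY]; split=> //.
  have : infinite_set (R `&` Y).
    by move=> fRY; apply: infR; rewrite -(setDUK (@subIsetl _ R Y)) setDIr setDv set0U finite_setU.
  by move=> /infinite_setN0[x [_ Yx]]; exists x.
have Kx : gset K x.
  apply: (Hx [set x | gset K x]); split; first exact: definable_mono CC' dK.1.
  by rewrite (_ : _ `\` _ = set0) //; apply/seteqP; split=> // y [/RK].
have [r Rr nrx] := net x Kx; have Kr := RK _ Rr.
have C'r v : C' (r v) by right; exists r => //; exists v.
suff : ~ ([/\ gset K r, gset K x & chi (r^- ** x)] /\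
          [/\ gset K x, gset K r & chi (x^- ** r)]) by case: nrx => n1 n2; apply.
apply: (Hx [set x | ~ ([/\ gset K r, gset K x & chi (r^- ** x)] /\
                         [/\ gset K x, gset K r & chi (x^- ** r)])]).
split.
  have dQ := definable_mono CC' (definable_quotient dchi).
  apply: definable_not; apply: definable_and.
    apply: (definable_subst dQ (r := fun x => join r x)).
    by apply: dterm_join (dterm_id _ _); apply: dterm_const.
  apply: (definable_subst dQ (r := fun x => join x r)).
  by apply: dterm_join; [apply: dterm_id|apply: dterm_const].
apply: (sub_finite_set _ (finite_set1 r)) => y [Ry /contrapT[[_ _ c1] [_ _ c2]]].
by apply/esym/Ra.
Qed.

(** Since [H] is closed under quotients, compactness gives a definable set around
    [H] whose quotients stay in [chi]. *)
Lemma definable_square_root H chi : is_subgroup K H -> type_definable C H ->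
  definable C chi -> H `<=` chi ->
  exists Z, [/\ definable C Z, H `<=` Z & forall x y, gset K x -> gset K y ->
    Z x -> Z y -> chi (x^- ** y)].
Proof.
move=> sH tH dchi Hchi; have [HK H1 HM HV] := (is_subgroupP gK H).1 sH.
apply: contrapT => nZ.
have [||t Ht] := @compact _ _ _ kappa_large sat_N (V + V)%type C
    [set Y | exists Z, [/\ definable C Z, H `<=` Z & Y = [set t : V + V -> N | Z (t \o inl) /\
       (Z (t \o inr) /\ ~ [/\ gset K (t \o inl), gset K (t \o inr)
        & chi ((t \o inl)^- ** (t \o inr))])]]] small_C.
- split; first by eexists; exists setT; split; last reflexivity; [exact: definable_True|].
  move=> _ _ [Z [dZ HZ ->]] [Z' [dZ' HZ' ->]].
  exists [set t : V + V -> N | (Z `&` Z') (t \o inl) /\ ((Z `&` Z') (t \o inr) /\ ~ [/\ gset K (t \o inl), gset K (t \o inr)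
        & chi ((t \o inl)^- ** (t \o inr))])].
    exists (Z `&` Z'); split=> //; first exact: definable_and.
    by move=> x Hx; split; [apply: HZ|apply: HZ'].
  by move=> t [[? ?] [[? ?] ?]].
- move=> _ [Z [dZ HZ ->]]; split.
    apply: definable_and; first exact: (definable_subst dZ (dterm_comp inl (dterm_id _ _))).
    apply: definable_and; first exact: (definable_subst dZ (dterm_comp inr (dterm_id _ _))).
    exact/definable_not/definable_quotient.
  apply: contrapT => nt; apply: nZ; exists Z; split=> // x y Kx Ky Zx Zy.
  by apply: contrapT => nchi; apply: nt; exists (join x y); split=> //; split=> // -[].
have HZ Z : definable C Z -> H `<=` Z -> [/\ Z (t \o inl), Z (t \o inr) &
     ~ [/\ gset K (t \o inl), gset K (t \o inr) & chi ((t \o inl)^- ** (t \o inr))]].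
  move=> dZ HZ; have [|Zl [Zr n]] := Ht [set t : V + V -> N | Z (t \o inl) /\
       (Z (t \o inr) /\ ~ [/\ gset K (t \o inl), gset K (t \o inr)
        & chi ((t \o inl)^- ** (t \o inr))])]; last by split.
  by exists Z.
have [_ _ n] := HZ _ (definable_True C V) (fun _ _ => I).
have Hl : H (t \o inl).
  by have /type_definableP := tH; apply=> Z dZ /(HZ _ dZ)[].
have Hr : H (t \o inr).
  by have /type_definableP := tH; apply=> Z dZ /(HZ _ dZ)[].
by apply: n; split; [apply: HK|apply: HK|apply: Hchi; apply: HM => //; apply: HV].
Qed.

Lemma conn00_subgroup : type_definable C (conn00 kappa C K) /\ is_subgroup K (conn00 kappa C K).
Proof.
have Kin : [/\ is_subgroup K K, bounded_index kappa K K & type_definable C K].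
  have sK := is_subgroup_full gK; split=> //.
    apply: (bounded_index_map gK (J := [set tt]) (phi := fun=> tt) sK) => //.
      by apply: (small_finite kappa_large); apply: finite_set1.
    by move=> x y Kx Ky _; gin.
  exact: definable_type_definable dK.1.
split.
  have -> : conn00 kappa C K = [set x | forall H, [/\ is_subgroup K H,
      bounded_index kappa K H & type_definable C H] -> H x].
    apply/seteqP; split=> x H Y; first by move=> HY; apply: H; split.
    by move=> [HY _]; apply: H.
  by apply: type_definable_bigcap => H [].
apply/(is_subgroupP gK); split.
- by move=> x /(_ K); apply; split.
- by move=> H [[/(is_subgroupP gK)[_ H1 _ _] _ _] _].
- move=> x y Hx Hy H HH; have [[/(is_subgroupP gK)[_ _ HM _] _ _] _] := HH.
  by apply: HM; [apply: Hx|apply: Hy].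
- move=> x Hx H HH; have [[/(is_subgroupP gK)[_ _ _ HV] _ _] _] := HH.
  by apply: HV; apply: Hx.
Qed.

(** The coset of [x] is determined by the points of countably many finite nets,
    one for each definable set around a subgroup of bounded index, that are
    close to [x]; hence there are at most [2 ^ aleph_0] cosets. *)
Lemma bounded_index_conn00 : countable_language L -> countable C ->
  bounded_index kappa K (conn00 kappa C K).
Proof.
move=> cL cC; have [e He] := countably_many_definable (N := N) V cL cC.
pose good H := [/\ is_subgroup K H, bounded_index kappa K H & type_definable C H].
pose goodk k := definable C (e k) /\ exists2 H, good H & H `<=` e k.
have /choice[R HR] k : exists R : set (V -> N), finite_set R /\ (goodk k ->
    forall x, gset K x -> gset K x /\ exists2 r, R r & gset K r /\ e k (r^- ** x)).
  have [[dk [H [sH bH tH] Hk]]|ng] := pselect (goodk k); last first.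
    by exists set0; split=> //; apply: finite_set0.
  have [R [fR RK Rnet]] := finite_net sH bH dk Hk; exists R; split=> // _ x Kx.
  by split=> //; have [r Rr er] := Rnet x Kx; exists r => //; split=> //; apply: RK.
have /choice[i Hi] k : exists i : (V -> N) -> nat, {in R k &, injective i}.
  by apply/countable_injP/finite_set_countable; have [] := HR k.
have /choice[d Hd] (xk : (V -> N) * nat) : exists r, gset K xk.1 -> goodk xk.2 ->
    [/\ R xk.2 r, gset K r & e xk.2 (r^- ** xk.1)].
  have [[Kx gk]|n] := pselect (gset K xk.1 /\ goodk xk.2).
    by have [_ [r Rr [Kr er]]] := (HR xk.2).2 gk _ Kx; exists r.
  by exists point => Kx gk; case: n.
(* The function [k |-> d (x, k)], encoded by its graph. *)
pose phi x : set nat := [set c | exists2 k, goodk k & c = pickle (k, i k (d (x, k)))].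
have [_ s00] := conn00_subgroup.
apply: (bounded_index_map gK (phi := phi) s00 kappa_large) => // x y Kx Ky exy H [[sH bH tH] _].
have Kv : gset K (x^- ** y) by gin.
have /type_definableP := tH; apply=> chi dchi Hchi.
have [Z [dZ HZ Zchi]] := definable_square_root sH tH dchi Hchi.
have [k ek] := He Z dZ.
have gk : goodk k by split; [rewrite ek|exists H; rewrite ?ek].
have : phi y (pickle (k, i k (d (x, k)))) by rewrite -exy; exists k.
move=> [k' gk' /(pcan_inj pickleK)[ekk]]; rewrite -ekk.
have [Rx Krx ex] := Hd (x, k) Kx gk; have [Ry Kry ey] := Hd (y, k) Ky gk.
move=> /Hi; rewrite !inE => /(_ Rx Ry) E; rewrite /= ek in ex ey; rewrite -E in ey.
set r := d (x, k) in ex ey Krx.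
have <- : (r^- ** x)^- ** (r^- ** y) = x^- ** y.
  have Krv := gV gK Krx; have Kxv := gV gK Kx.
  by rewrite (gVM gK) // (gVV gK) // -(gA gK) // ?gKVl //; gin.
by apply: Zchi => //; gin.
Qed.

End BoundedConn00.

(** * Transfer to the elementary extension *)

Lemma uterm_id L I (S : I -> structure L) C (c : forall i, C -> S i) V :
  uterm c (fun i (x : V -> S i) => x).
Proof. exact: (uterm_var c id). Qed.

(** Structural proofs of uniform definability, with the hypotheses as atoms. *)
Ltac uterm_tac := repeat first
  [exact: uterm_id | exact: uterm_param | apply: uterm_join | apply: uterm_comp].

Ltac udef_tac := first
  [ match goal with H : udef _ _ |- _ => apply: (udef_subst H); by uterm_tac end
  | apply: udef_all; udef_tac
  | apply: udef_ex; udef_tac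
  | apply: udef_imp; udef_tac
  | apply: udef_and; udef_tac
  | apply: udef_eq; by uterm_tac ].

Section Star.
Variables (L : language) (M N : structure L) (j : M -> N).
Hypothesis j_elem : elementary_embedding j.

(** The small model is the world [true], the monster model the world [false]. *)
Definition world (b : bool) : structure L := if b then M else N.

Definition world_param (b : bool) : M -> world b :=
  match b with true => id | false => j end.

Definition world_param_in (B : set M) (b : bool) : B -> world b :=
  match b with true => val | false => j \o val end.

(** A statement about both worlds that is given by one sentence is transferred
    by elementarity. *)
Lemma udef_transfer (P : bool -> Prop) :
  udef world_param (fun b (_ : void -> world b) => P b) -> P true -> P false.
Proof.
move=> [phi H] PM; pose x (v : void) : M := match v with end.
apply/(H false (j \o x)); rewrite -(_ : j \o join x id = join (j \o x) j).
  by apply/j_elem/(H true x).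
by apply: funext => -[].
Qed.

Lemma star_image V (X : set (V -> M)) B x : definable B X -> star j X (j \o x) <-> X x.
Proof.
have E (y : V -> M) : j \o join y id = join (j \o y) j by apply: funext => -[].
move=> [phi eX]; split=> [[psi -> ]|]; first by rewrite -E /= j_elem.
move=> Xx; pose h (u : V + B) : V + M := match u with inl v => inl v | inr b => inr (val b) end.
have Eh (y : V -> M) : join y id \o h = join y val by apply: funext => -[].
exists (formula_map h phi).
  by rewrite eX; apply/seteqP; split=> y; rewrite /= sat_map Eh.
by rewrite -E; apply/j_elem; rewrite sat_map Eh; rewrite eX in Xx.
Qed.

Lemma udef_in_all B V (P : forall b, (V -> world b) -> Prop) :
  udef (@world_param_in B) P -> udef world_param P.
Proof.
move=> [phi H]; pose h (u : V + B) : V + M := match u with inl v => inl v | inr b => inr (val b) end.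
by exists (formula_map h phi) => -[] x; rewrite H sat_map;
  (have -> // : forall T (y : V -> T) (p : M -> T),
     join y p \o h = join y (p \o val) by move=> T y p; apply: funext => -[]).
Qed.

(** Two formulas that define the same set in [M] define the same set in [N], so
    that any uniform definition computes the star of a set. *)
Lemma star_udef (V : finType) (P : forall b, (V -> world b) -> Prop) :
  udef world_param P -> star j (P true) = P false.
Proof.
move=> dP; apply/seteqP; split=> y; last first.
  move=> Py; have [phi H] := dP; exists phi; last exact/(H false).
  by apply/seteqP; split=> x /(H true).
move=> [psi Ppsi].
have dpsi : udef world_param (fun b (x : V -> world b) => sat psi (join x (@world_param b))).
  by exists psi.
have E : forall x : V -> N, sat psi (join x j) -> P false x.
  apply: (udef_transfer (P := fun b => forall x : V -> world b,
    sat psi (join x (@world_param b)) -> P b x)); first by udef_tac.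
  by move=> x; rewrite Ppsi.
exact: E.
Qed.

Lemma udef_definable B (V : finType) (P : forall b, (V -> world b) -> Prop) :
  udef (@world_param_in B) P -> definable (j @` B) (P false).
Proof.
move=> [phi H].
have jB (b : B) : (j @` B) (j (val b)) by exists (val b) => //; apply: set_mem; apply: valP.
pose h (u : V + B) : V + (j @` B) := match u with
  inl v => inl v | inr b => inr (SigSub (mem_set (jB b))) end.
have Eh (y : V -> N) : join y val \o h = join y (j \o val) by apply: funext => -[].
exists (formula_map h phi); apply/seteqP.
by split=> y; rewrite (H false y) /= /realizes sat_map Eh.
Qed.

Definition star_family V (X : set (V -> M)) (b : bool) : set (V -> world b) :=
  match b with true => X | false => star j X end.

Arguments star_family {V} X b _.

Lemma udef_star_family B (V : finType) (X : set (V -> M)) :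
  definable B X -> udef (@world_param_in B) (star_family X).
Proof.
move=> [phi eX].
pose P b (x : V -> world b) := sat phi (join x (@world_param_in B b)).
have dP : udef (@world_param_in B) P by exists phi.
have -> : star_family X = P; last by [].
apply: functional_extensionality_dep => -[] /=; first exact: eX.
by rewrite -(star_udef (udef_in_all dP)) eX.
Qed.

Definition family_fun2 U V W (X : set (U -> M)) (Y : set (V -> M))
    (f : (U -> M) -> (V -> M) -> (W -> M)) (b : bool) :
    (U -> world b) -> (V -> world b) -> (W -> world b) :=
  match b with true => f | false => star_fun2 j X Y f end.

Arguments family_fun2 {U V W} X Y f b _ _.

(** In the extension the star of a graph is still the graph of a function. *)
Lemma udef_graph2 B (U V W : finType) (X : set (U -> M)) (Y : set (V -> M))
    (f : (U -> M) -> (V -> M) -> (W -> M)) :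
  definable B X -> definable B Y -> definable B (graph2 X Y f) ->
  udef (@world_param_in B) (fun b => graph2 (star_family X b) (star_family Y b)
    (family_fun2 X Y f b)).
Proof.
move=> dX dY dg.
have uX := udef_in_all (udef_star_family dX); have uY := udef_in_all (udef_star_family dY).
have ug := udef_in_all (udef_star_family dg).
suff E : star_family (graph2 X Y f) = (fun b => graph2 (star_family X b) (star_family Y b)
    (family_fun2 X Y f b)) by rewrite -E; apply: udef_star_family.
apply: functional_extensionality_dep => -[] //=.
have H1 : forall x y z, star j (graph2 X Y f) (join (join x y) z) -> star j X x /\ star j Y y.
  apply: (udef_transfer (P := fun b => forall (x : U -> world b) (y : V -> world b)
    (z : W -> world b), star_family (graph2 X Y f) b (join (join x y) z) ->
    star_family X b x /\ star_family Y b y)); first by udef_tac.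
  by move=> x y z /graph2P[].
have H2 : forall x y, star j X x -> star j Y y ->
    exists z, star j (graph2 X Y f) (join (join x y) z).
  apply: (udef_transfer (P := fun b => forall (x : U -> world b) (y : V -> world b),
    star_family X b x -> star_family Y b y -> exists z : W -> world b,
    star_family (graph2 X Y f) b (join (join x y) z))); first by udef_tac.
  by move=> x y Xx Yy; exists (f x y); apply/graph2P.
have H3 : forall x y z z', star j (graph2 X Y f) (join (join x y) z) ->
    star j (graph2 X Y f) (join (join x y) z') -> z = z'.
  apply: (udef_transfer (P := fun b => forall (x : U -> world b) (y : V -> world b)
    (z z' : W -> world b), star_family (graph2 X Y f) b (join (join x y) z) ->
    star_family (graph2 X Y f) b (join (join x y) z') -> z = z')); first by udef_tac.
  by move=> x y z z' /graph2P[_ _ ->] /graph2P[_ _ ->].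
have fE x y z : star j (graph2 X Y f) (join (join x y) z) -> star_fun2 j X Y f x y = z.
  by move=> g; apply: xget_unique => // z' g'; apply: H3 g' g.
apply/seteqP; split=> t.
  rewrite -(joinK t) -(joinK (t \o inl)) => g.
  by apply/graph2P; have [? ?] := H1 _ _ _ g; split=> //; rewrite (fE _ _ _ g).
rewrite -(joinK t) -(joinK (t \o inl)) => /graph2P[Xx Yy ->].
by have [z g] := H2 _ _ Xx Yy; rewrite (fE _ _ _ g).
Qed.

(** * Transfer of group axioms *)

Definition family_group V (K : pregroup (V -> M)) (b : bool) : pregroup (V -> world b) :=
  match b with true => K | false => star_group j K end.

Section TransferGroup.
Variables (B : set M) (V : finType) (K : pregroup (V -> M)).
Hypotheses (gK : is_group K) (dK : definable_group B K).

Lemma udef_family_group : udef (@world_param_in B) (fun b => gset (family_group K b)).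
Proof.
by apply: (udef_ext (udef_star_family dK.1)) => -[].
Qed.

Lemma udef_family_mul : udef (@world_param_in B) (fun b =>
  graph2 (family_group K b) (family_group K b) (gmul (family_group K b))).
Proof. by apply: (udef_ext (udef_graph2 dK.1 dK.1 dK.2)) => -[]. Qed.

(** The axioms are written with the graph of the multiplication, which is
    uniformly definable, in place of the operation itself. *)
Lemma is_group_star : is_group (star_group j K).
Proof.
have uK := udef_in_all udef_family_group; have um := udef_in_all udef_family_mul.
set S := star_group j K.
pose R b (x y z : V -> world b) := graph2 (family_group K b) (family_group K b)
  (gmul (family_group K b)) (join (join x y) z).
pose F b : pregroup (V -> world b) := family_group K b.
have S1 : gset S (gone S).
  apply: (udef_transfer (P := fun b => gset (family_group K b) (@world_param b \o gone K))).
    by udef_tac.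
  exact: (g1 gK).
have SM x y : gset S x -> gset S y -> gset S (gmul S x y).
  move=> Sx Sy.
  have H : forall x y z, R false x y z -> gset S z.
    apply: (udef_transfer (P := fun b => forall x y z, R b x y z -> gset (F b) z)).
      by udef_tac.
    by move=> a b c /graph2P[Ka Kb ->]; apply: (gM gK).
  by apply: (H x y); apply/graph2P.
split=> //.
- move=> x y z Sx Sy Sz.
  have H : forall x y z u v w w', R false y z u -> R false x u v -> R false x y w ->
      R false w z w' -> v = w'.
    apply: (udef_transfer (P := fun b => forall x y z u v w w', R b y z u -> R b x u v ->
      R b x y w -> R b w z w' -> v = w')); first by udef_tac.
    move=> a b c u v w w' /graph2P[Kb Kc ->] /graph2P[Ka _ ->] /graph2P[_ _ ->].
    by move=> /graph2P[_ _ ->]; apply: (gA gK).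
  by apply: (H x y z (gmul S y z) _ (gmul S x y)); apply/graph2P; split; auto.
- move=> x Sx.
  have H : forall x, gset S x -> R false (gone S) x x /\ R false x (gone S) x.
    apply: (udef_transfer (P := fun b => forall x, gset (F b) x ->
      R b (@world_param b \o gone K) x x /\ R b x (@world_param b \o gone K) x)).
      by udef_tac.
    by move=> a Ka; split; apply/graph2P; split; rewrite ?g1l ?g1r //; apply: (g1 gK).
  by have [/graph2P[_ _ <-] /graph2P[_ _ <-]] := H x Sx.
- move=> x Sx.
  have H : forall x, gset S x -> exists y, R false x y (gone S) /\ R false y x (gone S).
    apply: (udef_transfer (P := fun b => forall x, gset (F b) x ->
      exists y, R b x y (@world_param b \o gone K) /\ R b y x (@world_param b \o gone K))).
      by udef_tac.
    move=> a Ka; exists (ginv K a); have Kv := gV gK Ka.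
    by split; apply/graph2P; rewrite (gVr gK, gVl gK).
  have [y [/graph2P[_ Sy e] /graph2P[_ _ e']]] := H x Sx.
  by exists y.
Qed.

Lemma definable_group_star : definable_group (j @` B) (star_group j K).
Proof.
by split; [apply: (udef_definable udef_family_group)|apply: (udef_definable udef_family_mul)].
Qed.

Lemma star_gmul x y : gset K x -> gset K y ->
  gmul (star_group j K) (j \o x) (j \o y) = j \o gmul K x y.
Proof.
move=> Kx Ky.
have := (star_udef (udef_in_all udef_family_mul)).
rewrite /= => /(congr1 (fun X => X (join (join (j \o x) (j \o y)) (j \o gmul K x y)))).
rewrite -!comp_join => E.
have : star j (graph2 K K (gmul K)) (j \o join (join x y) (gmul K x y)).
  by apply/(star_image _ dK.2)/graph2P.
by rewrite E !comp_join => /graph2P[].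
Qed.

Lemma star_gset x : gset (star_group j K) (j \o x) <-> gset K x.
Proof. exact: (star_image _ dK.1). Qed.

Lemma star_ginv x : gset K x ->
  ginv (star_group j K) (j \o x) = j \o ginv K x.
Proof.
move=> Kx; have gS := is_group_star; have Kv := gV gK Kx.
apply/esym/(gV_uniq gS); rewrite ?star_gset // star_gmul //.
by rewrite (gVr gK).
Qed.

End TransferGroup.

Lemma udef_definable_base B V (P : forall b, (V -> world b) -> Prop) :
  udef (@world_param_in B) P -> definable B (P true).
Proof.
by move=> [phi H]; exists phi; apply/seteqP; split=> x /(H true).
Qed.

(** * The extension defined by a cocycle *)

Section TransferExtension.
Variables (B : set M) (U V : finType) (G : pregroup (V -> M)) (A : pregroup (U -> M)).
Variables (act : (V -> M) -> (U -> M) -> (U -> M)) (h : (V -> M) -> (V -> M) -> (U -> M)).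
Hypotheses (gG : is_group G) (gA' : is_abelian_group A).
Hypotheses (dG : definable_group B G) (dA : definable_group B A).
Hypotheses (actP : acts_by_automorphisms G A act) (hP : is_cocycle G A act h).
Hypotheses (dact : definable B (graph2 G A act)) (dh : definable B (graph2 G G h)).

Let Gs := star_group j G.
Let As := star_group j A.
Let acts := star_fun2 j G A act.
Let hs := star_fun2 j G G h.

Local Notation FG b := (family_group G b).
Local Notation FA b := (family_group A b).
Local Notation Fact b := (family_fun2 G A act b).
Local Notation Fh b := (family_fun2 G G h b).
Local Notation Ract b x y z := (graph2 (FG b) (FA b) (Fact b) (join (join x y) z)).
Local Notation Rh b x y z := (graph2 (FG b) (FG b) (Fh b) (join (join x y) z)).
Local Notation RA b x y z := (graph2 (FA b) (FA b) (gmul (FA b)) (join (join x y) z)).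
Local Notation RG b x y z := (graph2 (FG b) (FG b) (gmul (FG b)) (join (join x y) z)).

Let uG := udef_family_group dG.
Let uA := udef_family_group dA.
Let umG := udef_family_mul dG.
Let umA := udef_family_mul dA.

Let uact : udef (@world_param_in B) (fun b => graph2 (FG b) (FA b) (Fact b)).
Proof. by apply: (udef_ext (udef_graph2 dG.1 dA.1 dact)) => -[]. Qed.

Let uh : udef (@world_param_in B) (fun b => graph2 (FG b) (FG b) (Fh b)).
Proof. by apply: (udef_ext (udef_graph2 dG.1 dG.1 dh)) => -[]. Qed.

Let aA := udef_in_all uA.
Let amG := udef_in_all umG.
Let amA := udef_in_all umA.
Let aact := udef_in_all uact.
Let ah := udef_in_all uh.

Lemma star_abelian x y : gset As x -> gset As y -> gmul As x y = gmul As y x.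
Proof.
move=> Ax Ay.
have H : forall x y z z', RA false x y z -> RA false y x z' -> z = z'.
  apply: (udef_transfer (P := fun b => forall x y z z', RA b x y z -> RA b y x z' -> z = z')).
    by move: amA => amA'; udef_tac.
  by move=> a b c d /graph2P[Aa Ab ->] /graph2P[_ _ ->]; apply: gA'.2.
by apply: (H x y); apply/graph2P.
Qed.

Lemma star_act_in g a : gset Gs g -> gset As a -> gset As (acts g a).
Proof.
move=> Gg Aa.
have H : forall x y z, Ract false x y z -> gset As z.
  apply: (udef_transfer (P := fun b => forall x y z, Ract b x y z -> gset (FA b) z)).
    by move: aact aA => H1 H2; udef_tac.
  by case: actP => H _ _ _ x y z /graph2P[? ? ->]; apply: H.
by apply: (H g a); apply/graph2P.
Qed.

Lemma star_act1 a : gset As a -> acts (gone Gs) a = a.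
Proof.
move=> Aa.
have H : forall x y, Ract false (gone Gs) x y -> y = x.
  apply: (udef_transfer (P := fun b => forall x y,
    Ract b (@world_param b \o gone G) x y -> y = x)).
    by move: aact => H1; udef_tac.
  by case: actP => _ H _ _ x y /graph2P[? ? ->]; apply: H.
by apply: (H a); apply/graph2P; split=> //; apply: g1; apply: (is_group_star gG dG).
Qed.

Lemma star_actD g a b : gset Gs g -> gset As a -> gset As b ->
  acts g (gmul As a b) = gmul As (acts g a) (acts g b).
Proof.
move=> Gg Aa Ab.
have H : forall g x y z u v w w', RA false x y z -> Ract false g z w ->
    Ract false g x u -> Ract false g y v -> RA false u v w' -> w = w'.
  apply: (udef_transfer (P := fun b => forall g x y z u v w w', RA b x y z -> Ract b g z w ->
    Ract b g x u -> Ract b g y v -> RA b u v w' -> w = w')).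
    by move: aact amA => H1 H2; udef_tac.
  case: actP => _ _ _ H k x y z u v w w' /graph2P[Ax Ay ->] /graph2P[Gk _ ->].
  by move=> /graph2P[_ _ ->] /graph2P[_ _ ->] /graph2P[_ _ ->]; apply: H.
have gAs := is_group_star gA'.1 dA.
apply: (H g a b (gmul As a b) (acts g a) (acts g b)); apply/graph2P; split=> //;
  by try apply: star_act_in => //; apply: (gM gAs).
Qed.

Lemma star_actM g k a : gset Gs g -> gset Gs k -> gset As a ->
  acts (gmul Gs g k) a = acts g (acts k a).
Proof.
move=> Gg Gk Aa.
have H : forall g k a l u v w, RG false g k l -> Ract false l a u ->
    Ract false k a v -> Ract false g v w -> u = w.
  apply: (udef_transfer (P := fun b => forall g k a l u v w, RG b g k l -> Ract b l a u ->
    Ract b k a v -> Ract b g v w -> u = w)).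
    by move: aact amG => H1 H2; udef_tac.
  case: actP => _ _ H _ x y a' l u v w /graph2P[Gx Gy ->] /graph2P[_ Aa' ->].
  by move=> /graph2P[_ _ ->] /graph2P[_ _ ->]; apply: H.
have gGs := is_group_star gG dG.
apply: (H g k a (gmul Gs g k) _ (acts k a)); apply/graph2P; split=> //;
  by try apply: star_act_in => //; apply: (gM gGs).
Qed.

Lemma star_cocycle_in g k : gset Gs g -> gset Gs k -> gset As (hs g k).
Proof.
move=> Gg Gk.
have H : forall x y z, Rh false x y z -> gset As z.
  apply: (udef_transfer (P := fun b => forall x y z, Rh b x y z -> gset (FA b) z)).
    by move: ah aA => H1 H2; udef_tac.
  by case: hP => H _ _ x y z /graph2P[? ? ->]; apply: H.
by apply: (H g k); apply/graph2P.
Qed.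

Lemma star_cocycle1 g : gset Gs g ->
  hs g (gone Gs) = gone As /\ hs (gone Gs) g = gone As.
Proof.
move=> Gg.
have H : forall x y, (Rh false x (gone Gs) y -> y = gone As) /\
    (Rh false (gone Gs) x y -> y = gone As).
  apply: (udef_transfer (P := fun b => forall x y,
    (Rh b x (@world_param b \o gone G) y -> y = @world_param b \o gone A) /\
    (Rh b (@world_param b \o gone G) x y -> y = @world_param b \o gone A))).
    by move: ah => H1; udef_tac.
  by case: hP => _ _ H x y; split=> /graph2P[? ? ->]; apply H.
have G1 : gset Gs (gone Gs) by apply: g1; apply: (is_group_star gG dG).
by split; [apply: (H g _).1|apply: (H g _).2]; apply/graph2P.
Qed.

Let Fext b : pregroup (U + V -> world b) := extension (FG b) (FA b) (Fact b) (Fh b).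

Let uext : udef (@world_param_in B) (fun b => gset (Fext b)).
Proof.
apply: (@udef_ext _ _ _ _ _ _ (fun b x => gset (FA b) (x \o inl) /\ gset (FG b) (x \o inr))).
  by move: uA uG => H1 H2; udef_tac.
move=> b x; split=> [[Ax Gx]|[a Aa [g Gg <-]]]; last by [].
by exists (x \o inl) => //; exists (x \o inr) => //; rewrite joinK.
Qed.

Let Fact_in b g a : gset (FG b) g -> gset (FA b) a -> gset (FA b) (Fact b g a).
Proof. by case: b g a => g a; [case: actP => + _ _ _; apply|apply: star_act_in]. Qed.

Let Fh_in b g k : gset (FG b) g -> gset (FG b) k -> gset (FA b) (Fh b g k).
Proof. by case: b g k => g k; [case: hP => + _ _; apply|apply: star_cocycle_in]. Qed.

Let FA_group b : is_group (FA b).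
Proof. by case: b; [apply: gA'.1|apply: (is_group_star gA'.1 dA)]. Qed.

Let umext : udef (@world_param_in B) (fun b => graph2 (Fext b) (Fext b) (gmul (Fext b))).
Proof.
pose P b (x y z : U + V -> world b) := exists u v w,
  [/\ Ract b (x \o inr) (y \o inl) u, RA b (x \o inl) u v & Rh b (x \o inr) (y \o inr) w] /\
  (RA b v w (z \o inl) /\ RG b (x \o inr) (y \o inr) (z \o inr)).
apply: (@udef_ext _ _ _ _ _ _ (fun b t => P b (t \o inl \o inl) (t \o inl \o inr) (t \o inr))).
  do 3 apply: udef_ex; apply: udef_and.
    apply: (@udef_ext _ _ _ _ _ _ (fun b t => _ /\ (_ /\ _))); last first.
      by move=> b t; split=> [[H1 [H2 H3]]|[H1 H2 H3]]; [split; [exact: H1|exact: H2|exact: H3]|do ?split].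
    by move: uact umA uh => H1 H2 H3; udef_tac.
  by move: umA umG => H2 H3; udef_tac.
move=> b t; rewrite -[in X in _ <-> X](joinK t) -[in X in _ <-> X](joinK (t \o inl)).
split=> [[u [v [w]]]|/graph2P[]].
  move=> [[/graph2P[Gx Ay eu] /graph2P[Ax _ ev] /graph2P[_ Gy ew]]].
  move=> [/graph2P[_ _ e1] /graph2P[_ _ e2]].
  apply/graph2P; split.
  - exists (t \o inl \o inl \o inl) => //; exists (t \o inl \o inl \o inr) => //; exact: joinK.
  - exists (t \o inl \o inr \o inl) => //; exists (t \o inl \o inr \o inr) => //; exact: joinK.
  - by rewrite /= -eu -ev -ew -e1 -e2 joinK.
move=> [a Aa [g Gg ex]] [d Ad [k Gk ey]] ez.
rewrite /P -ex -ey ez -ex -ey /= !join_inl !join_inr.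
have H1 := Fact_in Gg Ad; have H2 := gM (FA_group b) Aa H1; have H3 := Fh_in Gg Gk.
exists (Fact b g d), (gmul (FA b) a (Fact b g d)), (Fh b g k).
by split; [split|split]; apply/graph2P.
Qed.

Let Es := star_group j (extension G A act h).

Lemma definable_group_extension : definable_group B (extension G A act h).
Proof.
by split; [apply: (udef_definable_base uext)|apply: (udef_definable_base umext)].
Qed.

Lemma star_extension_group : is_group Es /\ definable_group (j @` B) Es.
Proof.
have gE := is_group_extension gG gA' actP hP.
by split; [apply: is_group_star definable_group_extension|
  apply: definable_group_star definable_group_extension].
Qed.

Lemma star_extension_gset x : gset Es x <-> gset As (x \o inl) /\ gset Gs (x \o inr).
Proof.
rewrite /Es /= (star_udef (udef_in_all uext)) /=.
split=> [[a Aa [g Gg <-]]|[Ax Gx]]; first by [].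
by exists (x \o inl) => //; exists (x \o inr) => //; rewrite joinK.
Qed.

(** The multiplication of the extension has the same description in terms of
    the action, the cocycle and the two groups in both worlds, by [umext]. *)
Lemma star_extension_gmul a g b k : gset As a -> gset Gs g -> gset As b -> gset Gs k ->
  gmul Es (join a g) (join b k) =
  join (gmul As (gmul As a (acts g b)) (hs g k)) (gmul Gs g k).
Proof.
move=> Aa Gg Ab Gk; have dE := definable_group_extension.
have e1 := star_udef (udef_in_all umext).
have e2 := star_udef (udef_in_all (udef_family_mul dE)).
have : graph2 (Fext false) (Fext false) (gmul (Fext false))
    (join (join (join a g) (join b k)) (gmul (Fext false) (join a g) (join b k))).
  by apply/graph2P; split=> //; [exists a => //; exists g|exists b => //; exists k].
by rewrite -e1 e2 => /graph2P[_ _ <-].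
Qed.

Lemma star_extension_gone : gone Es = join (gone As) (gone Gs).
Proof. exact: comp_join. Qed.

End TransferExtension.

End Star.

Arguments star_family {L M N} j {V} X b _.

(** * Automorphisms and definable groups *)

Section AutGroup.
Variables (L : language) (N : structure L) (C : set N) (V : Type) (K : pregroup (V -> N)).
Hypotheses (gK : is_group K) (dK : definable_group C K).
Variable s : N -> N.
Hypothesis As : Aut C s.

Lemma Aut_gset x : gset K (s \o x) <-> gset K x.
Proof. exact: Aut_definable dK.1. Qed.

Lemma Aut_gmul x y : gset K x -> gset K y ->
  s \o gmul K x y = gmul K (s \o x) (s \o y).
Proof.
move=> Kx Ky.
have : graph2 K K (gmul K) (s \o join (join x y) (gmul K x y)).
  by apply/(Aut_definable _ As dK.2)/graph2P.
by rewrite !comp_join => /graph2P[].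
Qed.

Lemma Aut_gone : s \o gone K = gone K.
Proof.
have K1 := g1 gK; have Ks := (Aut_gset _).2 K1.
by apply: (gIl gK Ks) => //; rewrite -Aut_gmul // (g1r gK) // (g1r gK).
Qed.

Lemma Aut_ginv x : gset K x -> s \o ginv K x = ginv K (s \o x).
Proof.
move=> Kx; have Kv := gV gK Kx; apply: (gV_uniq gK); rewrite ?Aut_gset //.
by rewrite -Aut_gmul // (gVr gK) // Aut_gone.
Qed.

End AutGroup.

(** * The splitting defines the connected component *)

Section Splitting.
Variables (L : language) (N : structure L) (kappa : Type).
Hypothesis kappa_large : small kappa [set: set nat].
Hypotheses (sat_N : saturated N kappa) (hom_N : strongly_homogeneous N kappa).
Hypothesis countable_L : countable_language L.
Variables (B : set N) (U V : finType).
Variables (G : pregroup (V -> N)) (A : pregroup (U -> N)) (E : pregroup (U + V -> N)).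
Variables (act : (V -> N) -> (U -> N) -> (U -> N)) (h : (V -> N) -> (V -> N) -> (U -> N)).
Hypothesis finite_B : finite_set B.
Hypotheses (gG : is_group G) (gA_ : is_group A) (gE : is_group E).
Hypothesis cA : forall x y, gset A x -> gset A y -> gmul A x y = gmul A y x.
Hypotheses (dG : definable_group B G) (dA : definable_group B A) (dE : definable_group B E).
Hypothesis E_set : forall x, gset E x <-> gset A (x \o inl) /\ gset G (x \o inr).
Hypothesis E_mul : forall a g b k, gset A a -> gset G g -> gset A b -> gset G k ->
  gmul E (join a g) (join b k) = join (gmul A (gmul A a (act g b)) (h g k)) (gmul G g k).
Hypothesis E_one : gone E = join (gone A) (gone G).
Hypothesis act_in : forall g a, gset G g -> gset A a -> gset A (act g a).
Hypothesis act1 : forall a, gset A a -> act (gone G) a = a.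
Hypothesis actM : forall g k a, gset G g -> gset G k -> gset A a ->
  act (gmul G g k) a = act g (act k a).
Hypothesis actD : forall g a b, gset G g -> gset A a -> gset A b ->
  act g (gmul A a b) = gmul A (act g a) (act g b).
Hypothesis h_in : forall g k, gset G g -> gset G k -> gset A (h g k).
Hypothesis h1 : forall g, gset G g -> h g (gone G) = gone A /\ h (gone G) g = gone A.

Variables (A1 A0 : set (U -> N)) (f : (V -> N) -> set (U -> N)).
Hypotheses (sA1 : is_subgroup A A1) (bA1 : bounded_index kappa A A1).
Hypothesis tA1 : type_definable B A1.
Hypothesis A1_act : forall g a, gset G g -> A1 a -> A1 (act g a).
Hypothesis sA0 : is_subgroup A A0.
Hypothesis A0_fixed : forall s a, Aut B s -> A0 a -> s \o a = a.

Let P := conn00 kappa B G.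
Let D := A1 `&` A0.
Hypothesis P_000 : conn000 kappa B G = P.
Hypothesis A1_000 : forall a, A1 a -> conn000 kappa B E (join a (gone G)).

Hypothesis f_inv : invariant_fun B P f.
Hypothesis f_split : split_via (subpregroup G P) (quotient (subpregroup A A0) D)
  (fun g X => [set act g a | a in X]) (fun g1 g2 => coset A D (h g1 g2)) f.

Local Notation "x + y" := (gmul A x y).
Local Notation "- x" := (ginv A x).
Local Notation "x ** y" := (gmul G x y) (at level 40, left associativity).
Local Notation "x *e y" := (gmul E x y) (at level 40, left associativity).

Let sB : small kappa B.
Proof. exact: small_finite. Qed.

Let tP : type_definable B P := (conn00_subgroup kappa_large gG dG).1.
Let sP : is_subgroup G P := (conn00_subgroup kappa_large gG dG).2.

Let bP : bounded_index kappa G P.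
Proof.
by apply: bounded_index_conn00 => //; apply: finite_set_countable.
Qed.

Let PG : P `<=` G. Proof. by have [] := (is_subgroupP gG P).1 sP. Qed.
Let P1 : P (gone G). Proof. by have [] := (is_subgroupP gG P).1 sP. Qed.
Let PM x y : P x -> P y -> P (x ** y).
Proof. by have [_ _ + _] := (is_subgroupP gG P).1 sP; apply. Qed.
Let PV x : P x -> P (ginv G x).
Proof. by have [_ _ _ +] := (is_subgroupP gG P).1 sP; apply. Qed.
Let A1A : A1 `<=` A. Proof. by have [] := (is_subgroupP gA_ A1).1 sA1. Qed.
Let A1_1 : A1 (gone A). Proof. by have [] := (is_subgroupP gA_ A1).1 sA1. Qed.
Let A1M x y : A1 x -> A1 y -> A1 (x + y).
Proof. by have [_ _ + _] := (is_subgroupP gA_ A1).1 sA1; apply. Qed.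
Let A1V x : A1 x -> A1 (- x).
Proof. by have [_ _ _ +] := (is_subgroupP gA_ A1).1 sA1; apply. Qed.
Let A0A : A0 `<=` A. Proof. by have [] := (is_subgroupP gA_ A0).1 sA0. Qed.
Let A0V x : A0 x -> A0 (- x).
Proof. by have [_ _ _ +] := (is_subgroupP gA_ A0).1 sA0; apply. Qed.
Let A0M x y : A0 x -> A0 y -> A0 (x + y).
Proof. by have [_ _ + _] := (is_subgroupP gA_ A0).1 sA0; apply. Qed.
Let sD : is_subgroup A D := is_subgroupI gA_ sA1 sA0.

Let A1_divl x y : A1 x -> gset A y -> A1 (x + y) -> A1 y.
Proof.
by move=> Ax Ay Axy; rewrite -(gKl gA_ (A1A Ax) Ay); apply: A1M => //; apply: A1V.
Qed.

Let A_swapr x y z : gset A x -> gset A y -> gset A z -> x + y + z = x + z + y.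
Proof. by move=> Ax Ay Az; rewrite -!(gA gA_) // (cA Ay). Qed.

Let A_medial x y z w : gset A x -> gset A y -> gset A z -> gset A w ->
  (x + y) + (z + w) = (x + z) + (y + w).
Proof.
by move=> Ax Ay Az Aw; rewrite !(gA gA_) ?(A_swapr Ax Ay) //; apply: (gM gA_).
Qed.

Lemma splitting_coset g : P g -> exists2 a, A0 a & f g = coset A D a.
Proof. by case: f_split => + _ _ Pg => /(_ g Pg)[a A0a <-]; exists a. Qed.

Lemma splitting_A0 g c : P g -> f g c -> A0 c.
Proof. by move=> /splitting_coset[a A0a ->] [d [_ A0d] <-]; apply: A0M. Qed.

Lemma splitting_nonempty g : P g -> exists c, f g c.
Proof.
move=> /splitting_coset[a A0a ->]; exists a, (gone A); last by rewrite (g1r gA_) //; apply: A0A.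
by have [] := (is_subgroupP gA_ D).1 sD.
Qed.

Lemma splitting_one c : f (gone G) c -> A1 c.
Proof. by case: f_split => _ -> _ []. Qed.

(** On representatives the splitting condition is the additive cocycle
    identity up to an element of [A1]. *)
Lemma splitting_cocycle g k c1 c2 c12 : P g -> P k -> f g c1 -> f k c2 -> f (g ** k) c12 ->
  exists2 d, A1 d & c1 + act g c2 = (h g k + c12) + d.
Proof.
move=> Pg Pk fc1 fc2 fc12; have [_ DA0 DM DV] := (is_subgroupP gA_ D).1 sD.
have [_ _ /(_ g k Pg Pk) /= Efs] := f_split.
have Pgk := PM Pg Pk; have [a A0a fa] := splitting_coset Pgk.
set Q := quotient (subpregroup A A0) D in Efs; set Y := ginv _ _ in Efs.
have Aa := A0A A0a.
have [QY QfY] : gset Q Y /\ gmul Q (f (g ** k)) Y = D.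
  apply: (@xgetI _ point [set Y | gset Q Y /\ gmul Q (f (g ** k)) Y = gone Q] (coset A D (- a))).
  split; first by exists (- a) => //; apply: A0V.
  have Av := gV gA_ Aa.
  apply/seteqP; split=> x.
    rewrite fa => -[_ [d1 D1 <-]] [_ [d2 D2 <-]] <- /=.
    have Ad1 := A1A D1.1; have Ad2 := A1A D2.1.
    rewrite (cA Aa Ad1) (gA gA_) ?(gKr gA_) //; [exact: DM|by gin].
  move=> Dx; have Ax := A1A Dx.1; exists a; first by rewrite fa; exists (gone A) => //; rewrite (g1r gA_).
  by exists (- a + x); [exists x|rewrite /= (gKVl gA_)].
have [y Yy] : exists y, Y y.
  case: QY => b A0b <-; exists b, (gone A) => //=; rewrite (g1r gA_) //; exact: A0A.
have Ay : gset A y by case: QY Yy => b A0b <- [d [A1d _] <-] /=; apply: (gM gA_); [exact: A0A|exact: A1A].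
have A_1 := A0A (splitting_A0 Pg fc1); have A_2 := A0A (splitting_A0 Pk fc2); have A_12 := A0A (splitting_A0 Pgk fc12).
have Gg := PG Pg; have Gk := PG Pk; have Aact := act_in Gg A_2; have Ah := h_in Gg Gk.
have D12 : D (c12 + y) by rewrite -QfY; exists c12 => //; exists y.
have : coset A D (h g k) ((c1 + act g c2) + y).
  by rewrite Efs; exists (c1 + act g c2) => //; [exists c1 => //; exists (act g c2) => //; exists c2|exists y].
move=> [d [A1d _] Ed]; have Ad := A1A A1d; have A12y := gM gA_ A_12 Ay.
exists (d + - (c12 + y)); first by apply: A1M => //; apply: A1V; case: D12.
have Aw := gV gA_ A12y.
have Eq : (h g k + c12) + (d + - (c12 + y)) + y = h g k + d.
  rewrite A_medial // -[LHS](gA gA_) //; try by gin.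
  by rewrite (A_swapr A_12 Aw) // (gVr gA_) // (g1r gA_) //; gin.
by apply: (gIl gA_ Ay); try (by gin); rewrite !(cA Ay) ?Eq ?Ed //; gin.
Qed.

(** The graph of [- f], thickened by [A1]. *)
Definition splitting_group : set (U + V -> N) :=
  [set x : (U + V)%type -> N | [/\ P (x \o inr), gset A (x \o inl) &
  exists2 c, f (x \o inr) c & A1 ((x \o inl) + c)]].
Local Notation K := splitting_group.

Lemma splitting_indep g c c' a : P g -> f g c -> f g c' -> gset A a -> A1 (a + c) -> A1 (a + c').
Proof.
move=> Pg; have [b A0b ->] := splitting_coset Pg; have Ab := A0A A0b.
move=> [d [A1d _] <-] [d' [A1d' _] <-] Aa.
have Ad := A1A A1d; have Ad' := A1A A1d'.
rewrite !(gA gA_) // => H; apply: A1M => //.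
by rewrite -(gKr gA_ Ad (gM gA_ Aa Ab)); apply: A1M => //; apply: A1V.
Qed.

Lemma splitting_group_sub : K `<=` E.
Proof. by move=> x [/PG Gx Ax _]; apply/E_set. Qed.

Let E_mulE x y : gset E x -> gset E y -> x *e y =
  join (((x \o inl) + act (x \o inr) (y \o inl)) + h (x \o inr) (y \o inr))
       ((x \o inr) ** (y \o inr)).
Proof. by move=> /E_set[? ?] /E_set[? ?]; rewrite -{1}(joinK x) -{1}(joinK y) E_mul. Qed.

Let pi_mul x y : gset E x -> gset E y -> (x *e y) \o inr = (x \o inr) ** (y \o inr).
Proof. by move=> Ex Ey; rewrite E_mulE. Qed.

Let pi_inv x : gset E x -> ginv E x \o inr = ginv G (x \o inr).
Proof.
move=> Ex; have Ev := gV gE Ex; have [_ Gx] := (E_set x).1 Ex.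
have [_ Gv] := (E_set _).1 Ev.
by apply: (gV_uniq gG) => //; rewrite -pi_mul // (gVr gE) // E_one.
Qed.

(** The splitting identity makes [g |-> (- f g, g)] multiplicative modulo
    [A1]; stated as an equivalence, this gives products and inverses at once. *)
Lemma splitting_group_mulP x y : K x -> gset E y -> P (y \o inr) -> K (x *e y) <-> K y.
Proof.
move=> Kx Ey Py; have Ex := splitting_group_sub Kx; case: Kx => Px Ax [c1 fc1 A1c1].
have [Ay Gy] := (E_set y).1 Ey; have Gx := PG Px.
set a := x \o inl in Ax A1c1; set g := x \o inr in Px fc1 Gx.
set b := y \o inl in Ay; set k := y \o inr in Py Gy.
have [c2 fc2] := splitting_nonempty Py; have Pxy := PM Px Py; have [c12 fc12] := splitting_nonempty Pxy.
have [d A1d Ed] := splitting_cocycle Px Py fc1 fc2 fc12.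
have Ac1 := A0A (splitting_A0 Px fc1); have Ac2 := A0A (splitting_A0 Py fc2); have Ac12 := A0A (splitting_A0 Pxy fc12).
have Ah := h_in Gx Gy; have Agb := act_in Gx Ay; have Agc := act_in Gx Ac2; have Ad := A1A A1d.
have Key : (((a + act g b) + h g k) + c12) + d = (a + c1) + act g (b + c2).
  rewrite actD // -!(gA gA_) //; try by gin.
  rewrite (gA gA_ Ac1) // (cA Ac1 Agb) -(gA gA_) // Ed; congr gmul; congr gmul.
  by rewrite -!(gA gA_).
have bc2 := gM gA_ Ay Ac2; have Abc := act_in Gx bc2.
have E1 : K (x *e y) <-> A1 (((a + act g b) + h g k) + c12).
  rewrite E_mulE //; split=> [[_ Aab [c fc A1c]]|H].
    exact: (splitting_indep Pxy fc fc12).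
  by split=> //; [rewrite /=; gin|exists c12].
have E2 : K y <-> A1 (b + c2).
  split=> [[_ _ [c fc A1c]]|H]; first exact: (splitting_indep Py fc fc2).
  by split=> //; exists c2.
rewrite E1 E2; split=> H.
  have : A1 (act g (b + c2)) by apply: (A1_divl A1c1) => //; rewrite -Key; apply: A1M.
  by move/(A1_act (gV gG Gx)); rewrite -actM ?(gVl gG) ?act1 //; apply: gV.
have : A1 ((((a + act g b) + h g k) + c12) + d) by rewrite Key; apply: A1M => //; apply: A1_act.
rewrite cA; try by gin.
by apply: A1_divl => //; gin.
Qed.

Let incl (a : U -> N) := join a (gone G).

Let incl_E a : gset A a -> gset E (incl a).
Proof. by move=> Aa; apply/E_set; split=> //; apply: g1. Qed.

Let incl_mul a b k : gset A a -> gset A b -> gset G k ->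
  incl a *e join b k = join (a + b) k.
Proof.
move=> Aa Ab Gk; have G1 := g1 gG.
by rewrite E_mul // act1 // (h1 Gk).2 (g1r gA_) ?(g1l gG) //; apply: gM.
Qed.

Let incl_V a : gset A a -> ginv E (incl a) = incl (- a).
Proof.
move=> Aa; have Av := gV gA_ Aa; apply/esym/(gV_uniq gE); try exact: incl_E.
by rewrite incl_mul ?(gVr gA_) //; apply: g1.
Qed.

Lemma splitting_group_incl a : A1 a -> K (incl a).
Proof.
move=> A1a; split; [exact: P1|exact: A1A|have [c fc] := splitting_nonempty P1].
by exists c => //; apply: A1M => //; apply: splitting_one.
Qed.

Lemma splitting_group_ker x : K x -> x \o inr = gone G -> exists2 a, A1 a & x = incl a.
Proof.
move=> [Px Ax [c fc A1c]] e; exists (x \o inl); last by rewrite /incl -e joinK.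
rewrite e in fc; have A1c' := splitting_one fc; have Ac := A1A A1c'.
by apply: (A1_divl A1c') => //; rewrite cA.
Qed.

Lemma is_subgroup_splitting_group : is_subgroup E K.
Proof.
have K1 : K (gone E) by rewrite E_one; apply: splitting_group_incl.
have KV x : K x -> K (ginv E x).
  move=> Kx; have Ex := splitting_group_sub Kx; have [Px _ _] := Kx.
  apply/(splitting_group_mulP Kx); [exact: gV|by rewrite pi_inv //; apply: PV|by rewrite (gVr gE)].
apply/(is_subgroupP gE); split=> //; first exact: splitting_group_sub.
move=> x y Kx Ky; apply/(splitting_group_mulP Kx) => //; first exact: splitting_group_sub.
by case: Ky.
Qed.

Let KM x y : K x -> K y -> K (x *e y).
Proof. by have [_ _ + _] := (is_subgroupP gE K).1 is_subgroup_splitting_group; apply. Qed.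
Let KV x : K x -> K (ginv E x).
Proof. by have [_ _ _ +] := (is_subgroupP gE K).1 is_subgroup_splitting_group; apply. Qed.

Let P_invariant s x : Aut B s -> P (s \o x) <-> P x.
Proof. by move=> As; apply: (type_definable_invariant tP As). Qed.

Let A1_invariant s x : Aut B s -> A1 (s \o x) <-> A1 x.
Proof. by move=> As; apply: (type_definable_invariant tA1 As). Qed.

Lemma splitting_group_invariant : Defs.invariant B K.
Proof.
have one_way s x : Aut B s -> K x -> K (s \o x).
  move=> As [Px Ax [c fc A1c]]; have As' := (Aut_gset dA As _).2 Ax.
  split=> //; first exact/P_invariant.
  exists (s \o c); last first.
    rewrite (_ : s \o x \o inl = s \o (x \o inl)) // -(Aut_gmul dA As) //; first exact/A1_invariant.
    exact: A0A (splitting_A0 Px fc).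
  by rewrite (f_inv As Px); exists c.
move=> s As x; split; last exact: one_way.
have [t [At st ts]] := Aut_inv As.
by move=> /(one_way t _ At); rewrite (_ : t \o (s \o x) = x) //; apply: funext => i /=; rewrite st.
Qed.

(** A coset of [K] is determined by the coset of its projection modulo [P],
    and by the coset modulo [A1] that remains after translating to [P]. *)
Lemma bounded_index_splitting_group : bounded_index kappa E K.
Proof.
pose r X := xget point [set g | gset G g /\ coset G P g = X].
(* [r X] is a representative of the coset [X] of [P], so that [q x] lies over [P]. *)
pose q x := ginv E (join (gone A) (r (coset G P (x \o inr)))) *e x.
pose c x := xget point (f (q x \o inr)).
have A_1 := g1 gA_.
have rP x : gset E x -> gset G (r (coset G P (x \o inr))) /\
    coset G P (r (coset G P (x \o inr))) = coset G P (x \o inr).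
  move=> /E_set[_ Gx].
  by apply: (@xgetI _ point [set g | gset G g /\ coset G P g = _] (x \o inr)).
have rE x : gset E x -> gset E (join (gone A) (r (coset G P (x \o inr)))).
  by move=> /rP[? _]; apply/E_set.
have qP x : gset E x -> [/\ gset E (q x), P (q x \o inr) & f (q x \o inr) (c x)].
  move=> Ex; have [_ Gx] := (E_set x).1 Ex; have [Gr er] := rP x Ex.
  have Er := rE x Ex; have Erv := gV gE Er.
  have Pq : P (q x \o inr) by rewrite pi_mul // pi_inv //; apply/(coset_eqP gG sP).
  split=> //; first exact: gM.
  by have [c' fc'] := splitting_nonempty Pq; apply: xgetI fc'.
apply: (bounded_index_map gE (phi := fun x => (coset G P (x \o inr),
    coset A A1 ((q x \o inl) + c x))) is_subgroup_splitting_group (small_setX kappa_large bP bA1)).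
  move=> x Ex; have [Eq Pq fc] := qP x Ex; split => /=; first by exists (x \o inr) => //; case/E_set: Ex.
  exists ((q x \o inl) + c x) => //; apply: (gM gA_); first by case/E_set: Eq.
  exact: A0A (splitting_A0 Pq fc).
move=> x y Ex Ey [ePG eA].
have [Eqx Pqx fcx] := qP x Ex; have [Eqy Pqy fcy] := qP y Ey.
have Erx := rE x Ex.
have -> : ginv E x *e y = ginv E (q x) *e q y.
  rewrite /q -ePG (gVM gE) //; last exact: gV.
  rewrite (gVV gE) // -(gA gE) ?(gKVl gE) //; gin.
(* An element over [P] is a translate by [A] of an element of [K]. *)
have dec z c' : gset E z -> P (z \o inr) -> f (z \o inr) c' ->
    exists2 k, K k & z = incl (z \o inl + c') *e k.
  move=> /E_set[Az Gz] Pz fc; have Ac := A0A (splitting_A0 Pz fc); have Av := gV gA_ Ac.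
  exists (join (- c') (z \o inr)).
    by split=> //; exists c' => //=; rewrite (gVl gA_).
  by rewrite incl_mul ?(gKr gA_) ?joinK //; apply: (gM gA_).
have [kx Kkx ex] := dec _ _ Eqx Pqx fcx; have [ky Kky ey] := dec _ _ Eqy Pqy fcy.
have Aalpha z : gset E z -> gset A (q z \o inl + c z).
  move=> /qP[Eq Pq fc]; apply: (gM gA_); first by case/E_set: Eq.
  exact: A0A (splitting_A0 Pq fc).
have Ax := Aalpha x Ex; have Ay := Aalpha y Ey.
rewrite ex ey; have Ekx := splitting_group_sub Kkx; have Eky := splitting_group_sub Kky.
move/(coset_eqP gA_ sA1 Ax Ay): eA => A1xy.
have Eix := incl_E Ax; have Eiy := incl_E Ay; have Axv := gV gA_ Ax.
have Eixv := gV gE Eix; have Ekv := gV gE Ekx.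
rewrite (gVM gE) // -(gA gE) // ?(gA gE Eixv) //; try by gin.
rewrite incl_V // {1}/incl [X in _ *e (X *e _)]incl_mul //; last exact: (g1 gG).
by apply: KM; [apply: KV|apply: KM => //; apply: splitting_group_incl].
Qed.

(** These quotients generate [P], because [G] has no smaller invariant subgroup
    of bounded index, and the values of [f] on them are determined by the cocycle,
    because [f] is constant on types. *)
Definition type_quotients : set (V -> N) := [set z | exists x y,
  (P x /\ P y) /\ (same_type B x y /\ graph2 G G (gmul G) (join (join x z) y))].
Local Notation F := type_quotients.

Lemma type_quotients_sub : F `<=` P.
Proof.
move=> z [x [y [[Px Py] [_ /graph2P[Gx Gz exz]]]]].
by rewrite -(gKl gG Gx Gz) -exz; apply: PM => //; apply: PV.
Qed.

Lemma type_quotients_one : F (gone G).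
Proof.
exists (gone G), (gone G); split=> //; split; first by move=> X.
by have G1 := g1 gG; apply/graph2P; rewrite (g1r gG).
Qed.

Lemma type_quotients_inv z : F z -> F (ginv G z).
Proof.
move=> [x [y [[Px Py] [xy /graph2P[Gx Gz e]]]]]; exists y, x; split=> //.
split; first exact: same_type_sym.
have Gv := gV gG Gz; have Gy := PG Py.
by apply/graph2P; split=> //; rewrite e (gKr gG).
Qed.

Lemma type_definable_type_quotients : type_definable B F.
Proof.
do 2! apply: (type_definable_ex kappa_large sat_N sB) => //=.
apply: type_definable_and; apply: type_definable_and.
- exact: (type_definable_subst tP (dterm_comp inr (dterm_comp inl (dterm_id B _)))).
- exact: (type_definable_subst tP (dterm_comp inr (dterm_id B _))).
- apply: type_definable_same_type.
    exact: (dterm_comp inr (dterm_comp inl (dterm_id B _))).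
  exact: (dterm_comp inr (dterm_id B _)).
- apply/definable_type_definable/(definable_subst dG.2).
  apply: dterm_join; last exact: (dterm_comp inr (dterm_id B _)).
  apply: dterm_join; first exact: (dterm_comp inr (dterm_comp inl (dterm_id B _))).
  exact: (dterm_comp inl (dterm_comp inl (dterm_id B _))).
Qed.

Let F_G : F `<=` G. Proof. by move=> z /type_quotients_sub/PG. Qed.

Let tpow k : type_definable B (powset G F k).
Proof.
exact: (type_definable_powset kappa_large sat_N sB gG dG k F_G type_quotients_one type_definable_type_quotients).
Qed.

(** The subgroup generated by [F] has bounded index: modulo the bounded index
    of [P], its cosets are determined by types over [B]. *)
Lemma conn00_generated : P `<=` \bigcup_k powset G F k.
Proof.
have sF := is_subgroup_powers gG F_G type_quotients_inv.
rewrite -P_000 => x; apply; split=> //; split=> //; last first.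
  move=> s As y; split=> -[k _ Hk]; exists k => //;
  by have := type_definable_invariant (tpow k) As y; tauto.
have [e He] := countably_many_definable (N := N) V countable_L (finite_set_countable finite_B).
pose r X := xget point [set g | gset G g /\ coset G P g = X].
have rP y : gset G y -> gset G (r (coset G P y)) /\ coset G P (r (coset G P y)) = coset G P y.
  by move=> Gy; apply: (@xgetI _ point [set g | gset G g /\ coset G P g = _] y).
pose q y := ginv G (r (coset G P y)) ** y.
have qP y : gset G y -> P (q y).
  by move=> Gy; have [Gr er] := rP y Gy; apply/(coset_eqP gG sP).
apply: (bounded_index_map gG (phi := fun y => (coset G P y, [set k | e k (q y)])) sF
  (small_setX kappa_large bP kappa_large)).
  by move=> y Gy; split=> //=; exists y.
move=> y z Gy Gz [eP eq]; exists 1%N => //.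
have Pqy := qP y Gy; have Pqz := qP z Gz; have [Gr _] := rP y Gy.
apply: (powset1 gG F_G); exists (q y), (q z); split=> //; split.
  move=> X dX; have [k <-] := He X dX => Xy.
  by have : [set k | e k (q y)] k by []; rewrite eq.
have Gv := gV gG Gr; have Gyv := gV gG Gy.
apply/graph2P; split; [exact: PG|by gin|].
rewrite /q -eP -(gA gG) ?(gKVl gG) //; gin.
Qed.

Lemma conn00_powset : exists k, P `<=` powset G F k.
Proof.
apply: (@finitely_many_steps _ _ _ kappa_large sat_N _ _ _ sB gG dG P (powset G F) sP tP tpow).
- by move=> x /conn00_generated[k _ ?]; exists k.
- by move=> k l x y; apply: (powsetM gG F_G).
- by move=> k x; apply: (powsetV gG F_G type_quotients_inv).
- by move=> k l; apply: (powset_mono gG F_G type_quotients_one).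
Qed.

(** The elements [(0, x)^-1 (0, y)] of the extension above [type_quotients];
    they are in [K] since [f x = f y].
    The witness [o] makes the zero of [A] available
    to a formula over [B]. *)
Definition lifted_quotients : set (U + V -> N) := [set z : (U + V)%type -> N | exists x y o,
  ((P x /\ P y) /\ same_type B x y) /\
  (o = gone A /\ graph2 E E (gmul E) (join (join (join o x) z) (join o y)))].
Local Notation Ft := lifted_quotients.

Lemma type_definable_lifted_quotients : type_definable B Ft.
Proof.
do 3! apply: (type_definable_ex kappa_large sat_N sB) => //=.
apply: type_definable_and; first (apply: type_definable_and; first apply: type_definable_and).
- exact: (type_definable_subst tP (dterm_comp inr (dterm_comp inl (dterm_comp inl (dterm_id B _))))).
- exact: (type_definable_subst tP (dterm_comp inr (dterm_comp inl (dterm_id B _)))).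
- apply: type_definable_same_type.
    exact: (dterm_comp inr (dterm_comp inl (dterm_comp inl (dterm_id B _)))).
  exact: (dterm_comp inr (dterm_comp inl (dterm_id B _))).
- apply/definable_type_definable/definable_and.
    exact: (definable_subst (definable_gone gA_ dA) (dterm_comp inr (dterm_id B _))).
  apply: (definable_subst dE.2).
  have d1 := dterm_comp inr (dterm_id B (((U + V + V) + V) + U)%type).
  have d2 := dterm_comp inr (dterm_comp inl (dterm_id B (((U + V + V) + V) + U)%type)).
  have d3 := dterm_comp inr (dterm_comp inl (dterm_comp inl (dterm_id B (((U + V + V) + V) + U)%type))).
  have d4 := dterm_comp inl (dterm_comp inl (dterm_comp inl (dterm_id B (((U + V + V) + V) + U)%type))).
  by apply: dterm_join; [apply: dterm_join; [apply: dterm_join|]|apply: dterm_join].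
Qed.

(** An automorphism over [B] that maps [x] to [y] maps [f x] to [f y], and it
    fixes [f x], a subset of [A0], pointwise. *)
Lemma splitting_same_type x y : P x -> same_type B x y -> f y = f x.
Proof.
move=> Px xy; have [s As <-] := homogeneous kappa_large hom_N sB xy.
rewrite (f_inv As Px); apply/seteqP; split=> c.
  by move=> [c' fc' <-]; rewrite (A0_fixed As) //; apply: splitting_A0 fc'.
by move=> fc; exists c => //; apply: A0_fixed => //; apply: splitting_A0 fc.
Qed.

Lemma lifted_quotients_splitting_group : Ft `<=` K.
Proof.
move=> z [x [y [_ [[[Px Py] xy] [-> /graph2P[Ex Ez e]]]]]].
have [c fc] := splitting_nonempty Px; have Ac := A0A (splitting_A0 Px fc); have Av := gV gA_ Ac.
have fyc : f y c by rewrite (splitting_same_type Px xy).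
have Gx := PG Px; have Gy := PG Py; have A_1 := g1 gA_.
have in_K g : P g -> f g c -> K (incl (- c) *e join (gone A) g).
  move=> Pg fg; rewrite incl_mul // ?(g1r gA_) //; last exact: PG.
  by split=> //; exists c => //=; rewrite (gVl gA_).
have Ei := incl_E Av.
apply/(splitting_group_mulP (in_K x Px fc)) => //; last by rewrite -(gA gE) // -e; apply: in_K.
have : (join (gone A) x *e z) \o inr = y by rewrite -e.
rewrite pi_mul //= => exz; have [_ Gz] := (E_set z).1 Ez.
by rewrite -(gKl gG Gx Gz) exz; apply: PM => //; apply: PV.
Qed.

Let Ft_E : Ft `<=` E. Proof. by move=> z /lifted_quotients_splitting_group/splitting_group_sub. Qed.

Lemma lifted_quotients_one : Ft (gone E).
Proof.
exists (gone G), (gone G), (gone A); split; first by split=> // X.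
have E1 := g1 gE; split=> //; rewrite -E_one; apply/graph2P; split=> //.
by rewrite (g1r gE).
Qed.

Lemma type_quotients_lift z : F z -> exists2 t, Ft t & t \o inr = z.
Proof.
move=> [x [y [[Px Py] [xy /graph2P[Gx Gz e]]]]].
have Gy := PG Py; have A_1 := g1 gA_.
have Ex : gset E (join (gone A) x) by apply/E_set.
have Ey : gset E (join (gone A) y) by apply/E_set.
have Ev := gV gE Ex.
exists (ginv E (join (gone A) x) *e join (gone A) y).
  exists x, y, (gone A); split=> //; split=> //; apply/graph2P; split=> //; first by gin.
  by rewrite (gKVl gE).
by rewrite pi_mul // pi_inv //= e (gKl gG).
Qed.

Lemma powset_lift k g : powset G F k g -> exists2 x, powset E Ft k x & x \o inr = g.
Proof.
elim: k g => [_ ->|k IH _ [z [g [Fz Fg ->]]]]; first by exists (gone E); rewrite ?E_one.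
have [t Ft_t <-] := type_quotients_lift Fz; have [x Fx <-] := IH g Fg.
exists (t *e x); first by exists t, x.
by rewrite pi_mul //; [apply: Ft_E|apply: (powset_sub gE Ft_E) Fx].
Qed.

Lemma powset_lifted_quotients_splitting_group k : powset E Ft k `<=` K.
Proof.
elim: k => [_ ->|k IH _ [x [y [Fx Fy ->]]]].
  by have [] := (is_subgroupP gE K).1 is_subgroup_splitting_group.
by apply: KM; [apply: lifted_quotients_splitting_group|apply: IH].
Qed.

(** As [P] is covered by finitely many steps, [K] is a finite product of
    type-definable sets. *)
Lemma type_definable_splitting_group : type_definable B K.
Proof.
have [k Pk] := conn00_powset.
pose I1 := [set x : (U + V)%type -> N | A1 (x \o inl) /\ x \o inr = gone G].
have tI1 : type_definable B I1.
  apply: type_definable_and; first exact: (type_definable_subst tA1 (dterm_comp inl (dterm_id B _))).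
  apply/definable_type_definable.
  exact: (definable_subst (definable_gone gG dG) (dterm_comp inr (dterm_id B _))).
have I1K : I1 `<=` K.
  by move=> x [A1x e]; rewrite -(joinK x) e; apply: splitting_group_incl.
have tF := type_definable_powset kappa_large sat_N sB gE dE k Ft_E lifted_quotients_one type_definable_lifted_quotients.
suff -> : K = mulset E (powset E Ft k) I1.
  apply: (type_definable_mulset kappa_large sat_N sB dE) => // x.
    by move/powset_lifted_quotients_splitting_group/splitting_group_sub.
  by move/I1K/splitting_group_sub.
apply/seteqP; split=> x; last by move=> [y [z [/powset_lifted_quotients_splitting_group Ky /I1K Kz ->]]]; apply: KM.
move=> Kx; have [Px _ _] := Kx; have [y Fy ey] := powset_lift (Pk _ Px).
have Ky := powset_lifted_quotients_splitting_group Fy; have Ex := splitting_group_sub Kx; have Ey := splitting_group_sub Ky; have Ev := gV gE Ey.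
exists y, (ginv E y *e x); split=> //; last by rewrite (gKVl gE).
have [||a A1a ->] := @splitting_group_ker (ginv E y *e x); [by apply: KM => //; apply: KV| |by []].
by rewrite pi_mul // pi_inv // ey (gVl gG) //; apply: PG.
Qed.

(** For [H] as in the definition of the component, [H `&` K] projects onto [P],
    because [P] has no smaller invariant subgroup of bounded index, and the
    kernel [A1] of the projection of [K] lies in [H]. *)
Lemma splitting_group_sub_conn000 : K `<=` conn000 kappa B E.
Proof.
move=> x Kx H [[sH bH iH] _]; have [HE H1 HM HV] := (is_subgroupP gE H).1 sH.
have sHK := is_subgroupI gE sH is_subgroup_splitting_group.
have bHK := bounded_indexI gE kappa_large sH is_subgroup_splitting_group bH bounded_index_splitting_group.
have [HKE HK1 HKM HKV] := (is_subgroupP gE _).1 sHK.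
pose Q := [set g | exists2 y, (H `&` K) y & y \o inr = g].
have sQ : is_subgroup G Q.
  apply/(is_subgroupP gG); split.
  - by move=> _ [y /HKE/E_set[_ ?] <-].
  - by exists (gone E); rewrite ?E_one // -E_one.
  - move=> _ _ [y Hy <-] [z Hz <-]; exists (y *e z); first exact: HKM.
    by rewrite pi_mul //; apply: HKE.
  - move=> _ [y Hy <-]; exists (ginv E y); first exact: HKV.
    by rewrite pi_inv //; apply: HKE.
have PQ : P `<=` Q.
  rewrite -P_000 => g; apply; split=> //; split=> //.
    apply: (bounded_index_map gG (phi := fun g => coset E (H `&` K) (join (gone A) g)) sQ bHK).
      by move=> y Gy; exists (join (gone A) y) => //; apply/E_set; split=> //; apply: (g1 gA_).
    move=> y z Gy Gz; have A_1 := g1 gA_.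
    have Ey : gset E (join (gone A) y) by apply/E_set.
    have Ez : gset E (join (gone A) z) by apply/E_set.
    move=> /(coset_eqP gE sHK Ey Ez) HKyz.
    exists (ginv E (join (gone A) y) *e join (gone A) z) => //.
    by rewrite pi_mul ?pi_inv //; apply: gV.
  have one_way s y : Aut B s -> Q y -> Q (s \o y).
    move=> As [z [Hz Kz] <-]; exists (s \o z) => //.
    by split; [apply/(iH s As)|apply/(splitting_group_invariant As)].
  move=> s As y; split; last exact: one_way.
  have [t [At st ts]] := Aut_inv As.
  by move=> /(one_way t _ At); rewrite (_ : t \o (s \o y) = y) //; apply: funext => i /=; rewrite st.
have [Px _ _] := Kx; have [y [Hy Ky] ey] := PQ _ Px.
have Ex := splitting_group_sub Kx; have Ey := splitting_group_sub Ky; have Ev := gV gE Ey.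
rewrite -(gKVl gE Ey Ex); apply: HM => //.
have [||a A1a ->] := @splitting_group_ker (ginv E y *e x); first by apply: KM => //; apply: KV.
  by rewrite pi_mul // pi_inv // ey (gVl gG) //; apply: PG.
by apply: (A1_000 A1a); split.
Qed.

Lemma conn000_eq_conn00 : conn000 kappa B E = conn00 kappa B E.
Proof.
apply/seteqP; split=> x Hx H [HH _].
  by case: HH => sH bH tH; apply: Hx; split=> //; split=> //; apply: type_definable_invariant.
have Kx : K x.
  by apply: Hx; split=> //; split; [exact: is_subgroup_splitting_group|exact: bounded_index_splitting_group|exact: type_definable_splitting_group].
by apply: (splitting_group_sub_conn000 Kx); split.
Qed.

End Splitting.

(** * The subgroup generated by the values of the cocycle *)

Section Generated.
Variables (L : language) (M N : structure L) (j : M -> N).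
Hypothesis j_elem : elementary_embedding j.
Variables (B : set M) (U : finType) (A : pregroup (U -> M)) (S : set (U -> M)).
Hypotheses (gA_ : is_group A) (dA : definable_group B A).
Hypotheses (SA : S `<=` A) (Sdcl : S `<=` dcl B (V := U)).

Lemma generated_subgroup : is_subgroup A (generated A S).
Proof.
apply/(is_subgroupP gA_); split.
- move=> x; apply; split=> //; exact: is_subgroup_full.
- by move=> H [/(is_subgroupP gA_)[]].
- move=> x y Hx Hy H HH; have [/(is_subgroupP gA_)[_ _ HM _] _] := HH.
  by apply: HM; [apply: Hx|apply: Hy].
- move=> x Hx H HH; have [/(is_subgroupP gA_)[_ _ _ HV] _] := HH.
  by apply: HV; apply: Hx.
Qed.

Lemma image_generated_subgroup :
  is_subgroup (star_group j A) [set j \o a | a in generated A S].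
Proof.
have gAs := is_group_star j_elem gA_ dA.
have [HA H1 HM HV] := (is_subgroupP gA_ _).1 generated_subgroup.
apply/(is_subgroupP gAs); split.
- by move=> _ [a /HA Aa <-]; apply/(star_gset j_elem dA).
- by exists (gone A).
- move=> _ _ [a Ha <-] [b Hb <-]; exists (gmul A a b); first exact: HM.
  by rewrite (star_gmul j_elem dA) //; apply: HA.
- move=> _ [a Ha <-]; exists (ginv A a); first exact: HV.
  by rewrite (star_ginv j_elem gA_ dA) //; apply: HA.
Qed.

(** That [a] is the only element of its defining set transfers to [N]. *)
Lemma dcl_fixed (a : U -> M) s : dcl B a -> Aut (j @` B) s -> s \o (j \o a) = j \o a.
Proof.
move=> da As; have ua := udef_star_family j_elem da.
have uniq : forall x y, star j [set a] x -> star j [set a] y -> x = y.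
  have aa := udef_in_all ua.
  apply: (udef_transfer j_elem (P := fun b => forall x y : U -> world M N b,
    star_family j [set a] b x -> star_family j [set a] b y -> x = y)); first by udef_tac.
  by move=> x y -> ->.
have ja : star j [set a] (j \o a) by apply/(star_image j_elem _ da).
by apply: uniq => //; apply/(Aut_definable _ As (udef_definable ua)).
Qed.

Lemma generated_fixed s x : Aut (j @` B) s ->
  [set j \o a | a in generated A S] x -> s \o x = x.
Proof.
move=> As [a Ha <-].
have gAs := is_group_star j_elem gA_ dA; have dAs := definable_group_star j_elem dA.
suff : [set a : U -> M | gset A a /\ s \o (j \o a) = j \o a] a by case.
apply: Ha; split; last by move=> b Sb; split; [apply: SA|apply: dcl_fixed => //; apply: Sdcl].
apply/(is_subgroupP gA_); split.
- by move=> b [].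
- by split; [apply: g1|apply: (Aut_gone gAs dAs As)].
- move=> b c [Ab eb] [Ac ec]; split; first exact: gM.
  rewrite -(star_gmul j_elem dA) // (Aut_gmul dAs As); try by apply/(star_gset j_elem dA).
  by rewrite eb ec.
- move=> b [Ab eb]; split; first exact: gV.
  rewrite -(star_ginv j_elem gA_ dA) // (Aut_ginv gAs dAs As); last by apply/(star_gset j_elem dA).
  by rewrite eb.
Qed.

End Generated.

Theorem corollary2p8
  (L : language) (M : structure L) (m n : nat)
  (G : pregroup ('I_m -> M)) (A : pregroup ('I_n -> M))
  (act : ('I_m -> M) -> ('I_n -> M) -> ('I_n -> M))
  (B : set M)
  (h : ('I_m -> M) -> ('I_m -> M) -> ('I_n -> M))
  (N : structure L) (j : M -> N) (kappa : Type)
  (A1s : set ('I_n -> N)) :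
  countable_language L ->
  is_group G -> is_abelian_group A -> acts_by_automorphisms G A act ->
  definable_group set0 G -> definable_group set0 A ->
  definable set0 (graph2 G A act) ->
  finite_set B ->
  is_cocycle G A act h ->
  definable B (graph2 G G h) ->
  finite_set (cocycle_image G h) ->
  cocycle_image G h `<=` dcl B (V := 'I_n) ->
  monster j kappa ->
  let Bs := j @` B in
  let Gs := star_group j G in
  let As := star_group j A in
  let acts := star_fun2 j G A act in
  let hs := star_fun2 j G G h in
  let A0 := [set j \o a | a in generated A (cocycle_image G h)] in
  let D := A1s `&` A0 in
  let Gext := star_group j (extension G A act h) in
  let G00 := conn00 kappa Bs Gs in
  is_subgroup As A1s -> bounded_index kappa As A1s ->
  type_definable Bs A1s ->
  (forall g a, gset Gs g -> A1s a -> A1s (acts g a)) ->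
  conn000 kappa Bs Gs = G00 ->
  [set join a (gone Gs) | a in A1s]
    `<=` conn000 kappa Bs Gext `&` [set join a (gone Gs) | a in As] ->
  conn000 kappa Bs Gext <> conn00 kappa Bs Gext ->
  nonsplit_via_invariant Bs
    (subpregroup Gs G00)
    (quotient (subpregroup As A0) D)
    (fun g X => [set acts g a | a in X])
    (fun g1 g2 => coset As D (hs g1 g2)).
Proof.
move=> cL gG abA actP dG0 dA0 dact0 finB hP dh finh hdcl [kl jel satN homN].
move=> Bs Gs As acts hs A0 D Gext G00 sA1 bA1 tA1 A1act P000 A1sub ne [f finv fsplit].
have kappa_large : small kappa [set: set nat].
  apply: small_le kl; apply: (@card_le_rel _ _ _ _ (fun X Y => Y = inr @` X)).
    by move=> X _; exists (inr @` X).
  move=> X X' Y _ _ -> e; apply/seteqP; split=> k Xk.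
    by have : (@inr M nat @` X) (inr k) by [exists k]; rewrite e => -[k' X'k' [<-]].
  by have : (@inr M nat @` X') (inr k) by [exists k]; rewrite -e => -[k' X'k' [<-]].
have B0 : set0 `<=` B by [].
have dG : definable_group B G by split; apply: definable_mono B0 _; case: dG0.
have dA : definable_group B A by split; apply: definable_mono B0 _; case: dA0.
have dact := definable_mono B0 dact0.
have gAs := is_group_star jel abA.1 dA.
have [gE dE] := star_extension_group jel gG abA dG dA actP hP dact dh.
have SA : cocycle_image G h `<=` A by move=> _ [g1 Gg1 [g2 Gg2 <-]]; case: hP => + _ _; apply.
apply: ne.
apply: (@conn000_eq_conn00 _ _ _ kappa_large satN homN cL Bs _ _ Gs As Gext acts hs
  _ _ _ _ _ _ _ _ _ _ _ _ _ _ _ _ _ A1s A0 f _ bA1 tA1 A1act _ _ P000 _ finv fsplit) => //.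
- exact: finite_image.
- exact: (is_group_star jel gG dG).
- by move=> x y; apply: (star_abelian jel abA dA).
- exact: (definable_group_star jel dG).
- exact: (definable_group_star jel dA).
- by move=> x; apply: (star_extension_gset jel act h dG dA).
- by move=> a g b k; apply: (star_extension_gmul jel abA dG dA actP hP dact dh).
- exact: star_extension_gone.
- by move=> g a; apply: (star_act_in jel dG dA actP dact).
- by move=> a; apply: (star_act1 jel gG dG dA actP dact).
- by move=> g k a; apply: (star_actM jel gG dG dA actP dact).
- by move=> g a b; apply: (star_actD jel abA dG dA actP dact).
- by move=> g k; apply: (star_cocycle_in jel dG dA hP dh).
- by move=> g; apply: (star_cocycle1 jel gG dG hP dh).
- exact: (image_generated_subgroup jel abA.1 dA SA).
- by move=> s a As'; apply: (generated_fixed jel abA.1 dA SA hdcl As').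
- by move=> a A1a; have [] := A1sub _ (ex_intro2 _ _ a A1a erefl).
Qed.
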